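(* Let $K\subseteq\mathbb{R}^d$ be compact. Then $(C^1(K),\|\cdot\|_{C^1(K)})$ is complete if and only if $K$ has finitely many connected components, each of which is pointwise Whitney regular.
   Context: $C^1(K)$ is the set of $f:K\to\mathbb{R}$ admitting a continuous $df:K\to\mathbb{R}^d$ with $\lim_{y\to x,\,y\in K\setminus\{x\}}\frac{f(y)-f(x)-\langle df(x),y-x\rangle}{|y-x|}=0$ for all $x\in K$, normed by $\|f\|_{C^1(K)}=\|f\|_K+\inf\{\|df\|_K: df \text{ a continuous derivative of } f\}$ ($\|\cdot\|_K$ the sup norm). A set $S$ is pointwise Whitney regular if for every $x\in S$ there are a neighbourhood $V_x$ of $x$ and $C_x>0$ such that every $y\in V_x\cap S$ is joined to $x$ by a rectifiable path in $S$ of length at most $C_x|x-y|$ (a rectifiable path is a continuous map $\gamma:[a,b]\to S$ of finite length $\sup\sum_j|\gamma(t_j)-\gamma(t_{j-1})|$). *)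

(* Defs.v *)
From Stdlib Require Import Reals List.
Open Scope R_scope.

(* Points of R^d are represented as  x : nat -> R  whose coordinates
   of index >= d vanish (the hypothesis [in_Rd] below); only the first
   d coordinates enter the Euclidean structure. *)
Definition vec := nat -> R.

Fixpoint sumR (n : nat) (f : nat -> R) : R :=
  match n with O => 0 | S k => sumR k f + f k end.

Definition dot (d : nat) (u v : vec) : R := sumR d (fun i => u i * v i).
Definition vnorm (d : nat) (u : vec) : R := sqrt (dot d u u).
Definition vsub (u v : vec) : vec := fun i => u i - v i.
Definition dist (d : nat) (x y : vec) : R := vnorm d (vsub x y).

Definition in_Rd (d : nat) (K : vec -> Prop) : Prop :=
  forall x, K x -> forall i, (d <= i)%nat -> x i = 0.

Definition seq_conv (d : nat) (u : nat -> vec) (x : vec) : Prop :=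
  forall eps, 0 < eps -> exists N, forall n, (N <= n)%nat -> dist d (u n) x < eps.

Definition seq_compact (d : nat) (K : vec -> Prop) : Prop :=
  forall u : nat -> vec, (forall n, K (u n)) ->
    exists phi : nat -> nat, (forall n, (phi n < phi (S n))%nat) /\
    exists x, K x /\ seq_conv d (fun n => u (phi n)) x.

Definition is_C1_deriv (d : nat) (K : vec -> Prop) (f : vec -> R) (df : vec -> vec) : Prop :=
  (forall x, K x -> forall eps, 0 < eps -> exists delta, 0 < delta /\
     forall y, K y -> dist d y x < delta -> dist d (df y) (df x) < eps) /\
  (forall x, K x -> forall eps, 0 < eps -> exists delta, 0 < delta /\
     forall y, K y -> 0 < dist d y x -> dist d y x < delta ->
       Rabs ((f y - f x - dot d (df x) (vsub y x)) / dist d y x) < eps).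

Definition inC1 (d : nat) (K : vec -> Prop) (f : vec -> R) : Prop :=
  exists df, is_C1_deriv d K f df.

(* sup over K of a nonnegative function h (value 0 for empty K) *)
Definition is_supK (K : vec -> Prop) (h : vec -> R) (s : R) : Prop :=
  is_lub (fun r => r = 0 \/ exists x, K x /\ r = h x) s.

Definition is_glb (E : R -> Prop) (m : R) : Prop :=
  (forall r, E r -> m <= r) /\ (forall b, (forall r, E r -> b <= r) -> b <= m).

Definition C1norm (d : nat) (K : vec -> Prop) (f : vec -> R) (r : R) : Prop :=
  exists s t, is_supK K (fun x => Rabs (f x)) s /\
    is_glb (fun u => exists df, is_C1_deriv d K f df /\
                     is_supK K (fun x => vnorm d (df x)) u) t /\
    r = s + t.

Definition fsub (f g : vec -> R) : vec -> R := fun x => f x - g x.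

Definition C1_complete (d : nat) (K : vec -> Prop) : Prop :=
  forall f : nat -> vec -> R,
    (forall n, inC1 d K (f n)) ->
    (forall eps, 0 < eps -> exists N, forall m n, (N <= m)%nat -> (N <= n)%nat ->
        exists r, C1norm d K (fsub (f m) (f n)) r /\ r < eps) ->
    exists g, inC1 d K g /\
      forall eps, 0 < eps -> exists N, forall n, (N <= n)%nat ->
        exists r, C1norm d K (fsub (f n) g) r /\ r < eps.

Definition open_set (d : nat) (U : vec -> Prop) : Prop :=
  forall x, U x -> exists r, 0 < r /\ forall y, dist d y x < r -> U y.

Definition connected (d : nat) (C : vec -> Prop) : Prop :=
  forall U V, open_set d U -> open_set d V ->
    (forall x, C x -> U x \/ V x) ->
    (forall x, C x -> U x -> V x -> False) ->
    (forall x, C x -> U x) \/ (forall x, C x -> V x).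

Definition component (d : nat) (K : vec -> Prop) (x : vec) : vec -> Prop :=
  fun y => exists C, (forall z, C z -> K z) /\ connected d C /\ C x /\ C y.

Definition finitely_many_components (d : nat) (K : vec -> Prop) : Prop :=
  exists l : list vec, (forall x, In x l -> K x) /\
    forall y, K y -> exists x, In x l /\ component d K x y.

Definition partition (a b : R) (n : nat) (t : nat -> R) : Prop :=
  t O = a /\ t n = b /\ forall j, (j < n)%nat -> t j <= t (S j).

Definition path_in (d : nat) (P : vec -> Prop) (gamma : R -> vec) (a b : R)
  (x y : vec) (L : R) : Prop :=
  a <= b /\
  (forall t, a <= t <= b -> P (gamma t)) /\
  (forall t, a <= t <= b -> forall eps, 0 < eps -> exists delta, 0 < delta /\
      forall s, a <= s <= b -> Rabs (s - t) < delta -> dist d (gamma s) (gamma t) < eps) /\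
  gamma a = x /\ gamma b = y /\
  (forall n t, partition a b n t ->
      sumR n (fun j => dist d (gamma (t (S j))) (gamma (t j))) <= L).

Definition pointwise_Whitney_regular (d : nat) (P : vec -> Prop) : Prop :=
  forall x, P x -> exists r Cx, 0 < r /\ 0 < Cx /\
    forall y, P y -> dist d y x < r ->
      exists gamma a b, path_in d P gamma a b x y (Cx * dist d x y).

(* Main.v *)
(** Sufficiency: the derivative [D] of the limit of a Cauchy sequence is the uniform limit of
    suitable derivatives of a subsequence.  Along a rectifiable path the increment of a C^1
    function is at most the length of the path times the supremum of the derivative, so pointwise
    Whitney regularity makes the difference quotients at a fixed point converge uniformly, and [D]
    is a derivative of the limit.

    Necessity: if C^1(K) is complete, the uniform boundedness principle gives, for each [x] in [K],
    a constant [C] with [|f y - f x| <= C |y - x|] for all [f] of norm at most 1 and all [y].  This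
    is applied to a smoothing (with a gradient bound independent of the dimension) of the truncated
    [eps]-chain distance from [x] in [K], which varies slowly at scale [eps].  Hence [x] and every
    nearby [y] are joined by [eps]-chains of length at most [C' |y - x|] for every [eps], and by
    Arzela-Ascoli by a path in [K] of that length.  In particular components are open in [K], so
    that there are only finitely many of them. *)

From Stdlib Require Import Reals List Lra Lia Arith ZArith.
From Stdlib Require Import Classical IndefiniteDescription FunctionalExtensionality Cantor.
Require Import Defs.
Open Scope R_scope.

(** * Euclidean space *)

Section Euclidean.
Context (d : nat).

(** The chain distance is 1-Lipschitz at scale [eps], but not differentiable, and it is controlled
    on [K] alone, where no convolution is at hand. Its smooth substitute needs a gradient bound that
    does not depend on [eps], since one and the same constant [C] serves all [eps]; an error of
    order [eps] in the values is harmless, being small against the distance of [x] and [y]. The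
    substitute is a soft minimum: the logarithm of a power sum of Euclidean bumps [w z] centred in
    [K]. Its gradient is a mean of the quotients [dw z / w z] with weights [w z ^ n]. These
    quotients blow up at the rim of a bump, but a high power [n] suppresses the points [z] where
    [w z] is small, and a mean does not grow with the number of bumps that overlap.

    In the other direction, derivatives on [K] are not unique and paths need not have a velocity. So
    derivatives of differences are selected from the norm and added up, and the mean value
    inequality is proved with inscribed polygons. *)

Lemma sumR_ext n f g : (forall i, (i < n)%nat -> f i = g i) -> sumR n f = sumR n g.
Proof.
  induction n as [|n IH]; intros H; simpl; [reflexivity|].
  rewrite (IH (fun i hi => H i (Nat.lt_lt_succ_r _ _ hi))), (H n (Nat.lt_succ_diag_r n)).
  reflexivity.
Qed.

Lemma sumR_plus n f g : sumR n (fun i => f i + g i) = sumR n f + sumR n g.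
Proof. induction n as [|n IH]; simpl; [lra|]. rewrite IH. lra. Qed.

Lemma sumR_scal n c f : sumR n (fun i => c * f i) = c * sumR n f.
Proof. induction n as [|n IH]; simpl; [lra|]. rewrite IH. lra. Qed.

Lemma sumR_nonneg n f : (forall i, (i < n)%nat -> 0 <= f i) -> 0 <= sumR n f.
Proof.
  induction n as [|n IH]; intros H; simpl; [lra|].
  apply Rplus_le_le_0_compat; [apply IH; intros; apply H; lia|apply H; lia].
Qed.

Lemma sumR_ge_term n f i :
  (forall j, (j < n)%nat -> 0 <= f j) -> (i < n)%nat -> f i <= sumR n f.
Proof.
  induction n as [|n IH]; intros H Hi; [lia|]. simpl.
  assert (H0 : 0 <= sumR n f) by (apply sumR_nonneg; intros; apply H; lia).
  destruct (Nat.eq_dec i n) as [->|Hn]; [lra|].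
  assert (f i <= sumR n f) by (apply IH; [intros; apply H|]; lia).
  assert (0 <= f n) by (apply H; lia). lra.
Qed.

Definition vadd (u v : vec) : vec := fun i => u i + v i.
Definition vscal (c : R) (u : vec) : vec := fun i => c * u i.
Definition vzero : vec := fun _ => 0.

Lemma dot_comm u v : dot d u v = dot d v u.
Proof. apply sumR_ext; intros; ring. Qed.

Lemma dot_add_l u v w : dot d (vadd u v) w = dot d u w + dot d v w.
Proof.
  unfold dot, vadd. rewrite <- sumR_plus. apply sumR_ext; intros; ring.
Qed.

Lemma dot_scal_l c u w : dot d (vscal c u) w = c * dot d u w.
Proof.
  unfold dot, vscal. rewrite <- sumR_scal. apply sumR_ext; intros; ring.
Qed.

Lemma dot_sub_l u v w : dot d (vsub u v) w = dot d u w - dot d v w.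
Proof.
  replace (dot d u w - dot d v w) with (dot d u w + (-1) * dot d v w) by ring.
  rewrite <- dot_scal_l, <- dot_add_l.
  apply sumR_ext; intros; unfold vsub, vadd, vscal; ring.
Qed.

Lemma dot_zero_l w : dot d vzero w = 0.
Proof.
  replace 0 with (0 * dot d vzero w) at 1 by ring.
  rewrite <- dot_scal_l. apply sumR_ext; intros; unfold vzero, vscal; ring.
Qed.

Lemma dot_self_nonneg u : 0 <= dot d u u.
Proof. apply sumR_nonneg; intros; nra. Qed.

Lemma vnorm_nonneg u : 0 <= vnorm d u.
Proof. apply sqrt_pos. Qed.

Lemma vnorm_sqr u : vnorm d u * vnorm d u = dot d u u.
Proof. apply sqrt_sqrt, dot_self_nonneg. Qed.

Lemma dot_sqr_le u v : dot d u v * dot d u v <= dot d u u * dot d v v.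
Proof.
  assert (H : forall t, 0 <= dot d u u - 2 * t * dot d u v + t * t * dot d v v).
  { intros t. pose proof (dot_self_nonneg (vsub u (vscal t v))) as H.
    rewrite dot_sub_l, (dot_comm u), (dot_comm (vscal t v)), !dot_sub_l in H.
    rewrite !dot_scal_l, (dot_comm u (vscal t v)), dot_scal_l, (dot_comm v u) in H.
    rewrite (dot_comm v (vscal t v)), dot_scal_l in H. lra. }
  pose proof (dot_self_nonneg u) as Hu. pose proof (dot_self_nonneg v) as Hv.
  destruct (Req_dec (dot d v v) 0) as [E|E].
  - destruct (Req_dec (dot d u v) 0) as [E'|E']; [rewrite E', E; lra|].
    (* With [dot d v v = 0] the nonnegative quadratic is affine in [t]; this [t] would give it the
       value -1. *)
    specialize (H ((dot d u u + 1) / (2 * dot d u v))). rewrite E in H.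
    replace (2 * ((dot d u u + 1) / (2 * dot d u v)) * dot d u v)
      with (dot d u u + 1) in H by (field; assumption). lra.
  - specialize (H (dot d u v / dot d v v)).
    replace (dot d u u - 2 * (dot d u v / dot d v v) * dot d u v +
      dot d u v / dot d v v * (dot d u v / dot d v v) * dot d v v)
      with ((dot d u u * dot d v v - dot d u v * dot d u v) / dot d v v) in H
      by (field; assumption).
    apply (Rmult_le_compat_r (dot d v v)) in H; [|lra].
    unfold Rdiv in H. rewrite Rmult_0_l, Rmult_assoc, Rinv_l in H by assumption. lra.
Qed.

Lemma Cauchy_Schwarz u v : Rabs (dot d u v) <= vnorm d u * vnorm d v.
Proof.
  pose proof (vnorm_nonneg u). pose proof (vnorm_nonneg v).
  apply Rsqr_incr_0_var; [|nra].
  rewrite <- Rsqr_abs. unfold Rsqr.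
  pose proof (dot_sqr_le u v) as H1. rewrite <- !vnorm_sqr in H1. lra.
Qed.

Lemma vnorm_ext u v : (forall i, (i < d)%nat -> u i = v i) -> vnorm d u = vnorm d v.
Proof. intros H; unfold vnorm, dot. f_equal. apply sumR_ext; intros i Hi. now rewrite H. Qed.

Lemma vnorm_zero : vnorm d vzero = 0.
Proof. unfold vnorm. rewrite dot_zero_l. apply sqrt_0. Qed.

Lemma vnorm_scal c u : vnorm d (vscal c u) = Rabs c * vnorm d u.
Proof.
  unfold vnorm. rewrite dot_scal_l, dot_comm, dot_scal_l, <- Rmult_assoc.
  rewrite sqrt_mult; [|nra|apply dot_self_nonneg].
  f_equal. apply sqrt_Rsqr_abs.
Qed.

Lemma vnorm_add u v : vnorm d (vadd u v) <= vnorm d u + vnorm d v.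
Proof.
  pose proof (vnorm_nonneg u). pose proof (vnorm_nonneg v).
  apply Rsqr_incr_0_var; [|lra]. unfold Rsqr.
  rewrite vnorm_sqr, dot_add_l, (dot_comm u), (dot_comm v (vadd u v)), !dot_add_l.
  pose proof (vnorm_sqr u). pose proof (vnorm_sqr v). rewrite (dot_comm v u).
  pose proof (Rle_abs (dot d u v)). pose proof (Cauchy_Schwarz u v). lra.
Qed.

Lemma abs_coord_le u i : (i < d)%nat -> Rabs (u i) <= vnorm d u.
Proof.
  intros Hi. rewrite <- sqrt_Rsqr_abs. apply sqrt_le_1_alt.
  apply (sumR_ge_term d (fun j => u j * u j)); [intros; nra|assumption].
Qed.

Lemma vnorm_le_sum u : vnorm d u <= sumR d (fun i => Rabs (u i)).
Proof.
  assert (H0 : forall n, 0 <= sumR n (fun i => Rabs (u i)))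
    by (intros n; apply sumR_nonneg; intros; apply Rabs_pos).
  apply Rsqr_incr_0_var; [|apply H0]. unfold Rsqr. rewrite vnorm_sqr. unfold dot.
  induction d as [|n IH]; simpl; [lra|].
  pose proof (H0 n). pose proof (Rabs_pos (u n)).
  assert (u n * u n = Rabs (u n) * Rabs (u n)) by apply (Rsqr_abs (u n)).
  nra.
Qed.

Lemma dist_nonneg x y : 0 <= dist d x y.
Proof. apply vnorm_nonneg. Qed.

Lemma dist_refl x : dist d x x = 0.
Proof.
  unfold dist. rewrite <- vnorm_zero. apply vnorm_ext. intros; unfold vsub, vzero; ring.
Qed.

Lemma dist_sym x y : dist d x y = dist d y x.
Proof.
  unfold dist. rewrite (vnorm_ext (vsub y x) (vscal (-1) (vsub x y))).
  - rewrite vnorm_scal, Rabs_left; lra.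
  - intros; unfold vsub, vscal; ring.
Qed.

Lemma dist_triangle x y z : dist d x z <= dist d x y + dist d y z.
Proof.
  unfold dist. rewrite (vnorm_ext (vsub x z) (vadd (vsub x y) (vsub y z))).
  - apply vnorm_add.
  - intros; unfold vsub, vadd; ring.
Qed.

Lemma dist_eq_0 x y :
  (forall i, (d <= i)%nat -> x i = 0) -> (forall i, (d <= i)%nat -> y i = 0) ->
  dist d x y = 0 -> x = y.
Proof.
  intros Hx Hy H. apply functional_extensionality; intros i.
  destruct (Nat.lt_ge_cases i d) as [Hi|Hi].
  - pose proof (abs_coord_le (vsub x y) i Hi) as H1.
    unfold dist in H. rewrite H in H1. unfold vsub in H1.
    destruct (Req_dec (x i) (y i)) as [E|E]; [exact E|].
    pose proof (Rabs_pos_lt (x i - y i)). lra.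
  - now rewrite Hx, Hy.
Qed.

(** [e k] bounds the whole tail beyond [k], so the limit inherits the same bound at every [k]. The
    distance sees only coordinates below [d], and nothing is claimed about the others. *)
Lemma cauchy_vec_limit (u : nat -> vec) (e : nat -> R) :
  (forall eps, 0 < eps -> exists k, e k < eps) ->
  (forall k l, (k <= l)%nat -> dist d (u l) (u k) <= e k) ->
  exists x, forall k, dist d x (u k) <= e k.
Proof.
  intros He Hu.
  assert (Hlim : forall i, exists l, (i < d)%nat -> Un_cv (fun k => u k i) l).
  { intros i. destruct (Nat.lt_ge_cases i d) as [Hi|Hi]; [|exists 0; lia].
    assert (Hc : Cauchy_crit (fun k => u k i)).
    { intros eps Heps. destruct (He (eps / 2)) as [k Hk]; [lra|]. exists k.
      intros n m Hn Hm. unfold Rdist.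
      pose proof (Hu k n Hn) as H1. pose proof (Hu k m Hm) as H2.
      pose proof (abs_coord_le (vsub (u n) (u k)) i Hi) as H3.
      pose proof (abs_coord_le (vsub (u m) (u k)) i Hi) as H4.
      unfold vsub in H3, H4. unfold dist, vsub in H1, H2.
      replace (u n i - u m i) with ((u n i - u k i) - (u m i - u k i)) by ring.
      pose proof (Rabs_triang (u n i - u k i) (- (u m i - u k i))) as H5.
      rewrite Rabs_Ropp in H5. unfold Rminus at 1. lra. }
    destruct (R_complete _ Hc) as [l Hl]. exists l. auto. }
  apply functional_choice in Hlim as [x Hx]. exists x. intros k.
  apply le_epsilon. intros eps Heps.
  assert (Hn : forall n, (n <= d)%nat -> forall eta, 0 < eta -> exists N, forall l, (N <= l)%nat ->
    sumR n (fun i => Rabs (x i - u l i)) < eta).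
  { induction n as [|n IH]; intros Hnd eta Heta.
    - exists 0%nat. intros; simpl; lra.
    - destruct (IH ltac:(lia) (eta / 2)) as [N1 HN1]; [lra|].
      destruct (Hx n ltac:(lia) (eta / 2)) as [N2 HN2]; [lra|].
      exists (max N1 N2). intros l Hl. simpl.
      specialize (HN1 l ltac:(lia)). specialize (HN2 l ltac:(lia)).
      unfold Rdist in HN2. rewrite Rabs_minus_sym in HN2. lra. }
  destruct (Hn d (le_n d) eps Heps) as [N HN].
  specialize (HN (max N k) ltac:(lia)). specialize (Hu k (max N k) ltac:(lia)).
  pose proof (vnorm_le_sum (vsub x (u (max N k)))) as H1. unfold vsub in H1.
  pose proof (dist_triangle x (u (max N k)) (u k)) as H2.
  unfold dist at 2, vsub in H2. lra.
Qed.

End Euclidean.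

(** * C^1 functions on a set *)

Section C1Calculus.
Context (d : nat) (K : vec -> Prop) (HK : in_Rd d K).

Definition hasD (f : vec -> R) (x p : vec) : Prop :=
  forall eps, 0 < eps -> exists delta, 0 < delta /\ forall y, K y -> dist d y x < delta ->
    Rabs (f y - f x - dot d p (vsub y x)) <= eps * dist d y x.

Definition contV (g : vec -> vec) (x : vec) : Prop :=
  forall eps, 0 < eps -> exists delta, 0 < delta /\
    forall y, K y -> dist d y x < delta -> dist d (g y) (g x) < eps.

Definition contR (g : vec -> R) (x : vec) : Prop :=
  forall eps, 0 < eps -> exists delta, 0 < delta /\
    forall y, K y -> dist d y x < delta -> Rabs (g y - g x) < eps.

Lemma K_dist_eq_0 x y : K x -> K y -> dist d x y = 0 -> x = y.
Proof. intros Hx Hy. apply dist_eq_0; intros i Hi; [now apply (HK x)|now apply (HK y)]. Qed.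

Lemma is_C1_deriv_hasD f df :
  is_C1_deriv d K f df <-> forall x, K x -> contV df x /\ hasD f x (df x).
Proof.
  split.
  - intros [H1 H2] x Hx. split; [exact (H1 x Hx)|].
    intros eps Heps. destruct (H2 x Hx eps Heps) as [delta [Hd H]].
    exists delta. split; [exact Hd|]. intros y Hy Hyx.
    destruct (Rle_lt_or_eq_dec 0 (dist d y x) (dist_nonneg d y x)) as [Hp|Hp].
    + specialize (H y Hy Hp Hyx). unfold Rdiv in H.
      rewrite Rabs_mult, (Rabs_right (/ dist d y x)) in H
        by (apply Rle_ge, Rlt_le, Rinv_0_lt_compat, Hp).
      apply (Rmult_lt_compat_r (dist d y x)) in H; [|exact Hp].
      rewrite Rmult_assoc, Rinv_l, Rmult_1_r in H by lra. lra.
    (* The quotient says nothing at distance 0; there [in_Rd] makes [y] and [x] equal as functions,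
       whence [f y = f x]. *)
    + rewrite <- Hp. rewrite (K_dist_eq_0 y x Hy Hx (eq_sym Hp)).
      rewrite dot_comm. replace (dot d (vsub x x) (df x)) with 0.
      * rewrite Rminus_diag, Rminus_0_r, Rabs_R0. lra.
      * rewrite dot_sub_l. ring.
  - intros H. split; [intros x Hx; exact (proj1 (H x Hx))|].
    intros x Hx eps Heps. destruct (proj2 (H x Hx) (eps / 2)) as [delta [Hd H']]; [lra|].
    exists delta. split; [exact Hd|]. intros y Hy Hp Hyx. specialize (H' y Hy Hyx).
    unfold Rdiv. rewrite Rabs_mult, (Rabs_right (/ dist d y x))
        by (apply Rle_ge, Rlt_le, Rinv_0_lt_compat, Hp).
    apply (Rmult_lt_reg_r (dist d y x)); [exact Hp|].
    rewrite Rmult_assoc, Rinv_l, Rmult_1_r by lra. nra.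
Qed.

Lemma hasD_ext f g x p : K x -> (forall y, K y -> f y = g y) -> hasD f x p -> hasD g x p.
Proof.
  intros Hx E H eps Heps. destruct (H eps Heps) as [delta [Hd H']].
  exists delta. split; [exact Hd|]. intros y Hy Hyx.
  rewrite <- (E x Hx), <- (E y Hy). auto.
Qed.

Lemma hasD_const c x : hasD (fun _ => c) x vzero.
Proof.
  intros eps Heps. exists 1. split; [lra|]. intros y _ _.
  rewrite dot_zero_l, Rminus_diag, Rminus_0_r, Rabs_R0.
  pose proof (dist_nonneg d y x). nra.
Qed.

Lemma hasD_add f g x p q :
  hasD f x p -> hasD g x q -> hasD (fun y => f y + g y) x (vadd p q).
Proof.
  intros Hf Hg eps Heps.
  destruct (Hf (eps / 2)) as [d1 [Hd1 H1]]; [lra|].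
  destruct (Hg (eps / 2)) as [d2 [Hd2 H2]]; [lra|].
  exists (Rmin d1 d2). split; [now apply Rmin_glb_lt|]. intros y Hy Hyx.
  specialize (H1 y Hy (Rlt_le_trans _ _ _ Hyx (Rmin_l _ _))).
  specialize (H2 y Hy (Rlt_le_trans _ _ _ Hyx (Rmin_r _ _))).
  rewrite dot_add_l.
  replace (f y + g y - (f x + g x) - (dot d p (vsub y x) + dot d q (vsub y x)))
    with ((f y - f x - dot d p (vsub y x)) + (g y - g x - dot d q (vsub y x))) by ring.
  eapply Rle_trans; [apply Rabs_triang|]. lra.
Qed.

Lemma hasD_local_lipschitz f x p : hasD f x p ->
  forall eps, 0 < eps -> exists delta, 0 < delta /\ forall y, K y -> dist d y x < delta ->
    Rabs (f y - f x) <= (vnorm d p + eps) * dist d y x.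
Proof.
  intros H eps Heps. destruct (H eps Heps) as [delta [Hd H']].
  exists delta. split; [exact Hd|]. intros y Hy Hyx. specialize (H' y Hy Hyx).
  replace (f y - f x) with ((f y - f x - dot d p (vsub y x)) + dot d p (vsub y x)) by ring.
  eapply Rle_trans; [apply Rabs_triang|].
  pose proof (Cauchy_Schwarz d p (vsub y x)) as H1. unfold dist in *. lra.
Qed.

Lemma hasD_contR f x p : hasD f x p -> contR f x.
Proof.
  intros H eps Heps. destruct (hasD_local_lipschitz f x p H 1 Rlt_0_1) as [delta [Hd H']].
  pose proof (vnorm_nonneg d p) as Hp.
  exists (Rmin delta (eps / (vnorm d p + 1))).
  split; [apply Rmin_glb_lt; [exact Hd|apply Rdiv_lt_0_compat; lra]|].
  intros y Hy Hyx. specialize (H' y Hy (Rlt_le_trans _ _ _ Hyx (Rmin_l _ _))).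
  apply (Rle_lt_trans _ _ _ H').
  apply (Rlt_le_trans _ _ _ (Rmult_lt_compat_l (vnorm d p + 1) _ _ ltac:(lra)
    (Rlt_le_trans _ _ _ Hyx (Rmin_r _ _)))).
  apply Req_le. field. lra.
Qed.

Lemma hasD_comp f x p phi c : K x ->
  hasD f x p -> derivable_pt_lim phi (f x) c -> hasD (fun y => phi (f y)) x (vscal c p).
Proof.
  intros Hx Hf Hphi eps Heps.
  pose proof (vnorm_nonneg d p) as Hp. pose proof (Rabs_pos c) as Hc.
  set (M := vnorm d p + 1).
  assert (He1 : 0 < eps / (2 * M)) by (apply Rdiv_lt_0_compat; unfold M; lra).
  assert (He2 : 0 < eps / (2 * (Rabs c + 1))) by (apply Rdiv_lt_0_compat; lra).
  destruct (Hphi _ He1) as [[d0 Hd0] H0]. simpl in H0.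
  destruct (hasD_local_lipschitz f x p Hf 1 Rlt_0_1) as [d1 [Hd1 H1]].
  destruct (hasD_contR f x p Hf d0 Hd0) as [d2 [Hd2 H2]].
  destruct (Hf _ He2) as [d3 [Hd3 H3]].
  exists (Rmin d1 (Rmin d2 d3)).
  split; [repeat apply Rmin_glb_lt; assumption|].
  intros y Hy Hyx.
  assert (L1 := Rmin_l d1 (Rmin d2 d3)). assert (L2 := Rmin_r d1 (Rmin d2 d3)).
  assert (L3 := Rmin_l d2 d3). assert (L4 := Rmin_r d2 d3).
  specialize (H1 y Hy ltac:(lra)). specialize (H2 y Hy ltac:(lra)).
  specialize (H3 y Hy ltac:(lra)).
  rewrite dot_scal_l. set (h := f y - f x) in *.
  (* [derivable_pt_lim] speaks of nonzero increments only, so [h = 0] is treated apart. *)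
  assert (Hh : Rabs (phi (f y) - phi (f x) - c * h) <= eps / (2 * M) * Rabs h).
  { destruct (Req_dec h 0) as [E|E].
    - replace (f y) with (f x) by (unfold h in E; lra). rewrite E, Rmult_0_r.
      replace (phi (f x) - phi (f x) - 0) with 0 by ring. rewrite !Rabs_R0. lra.
    - specialize (H0 h E H2). replace (f x + h) with (f y) in H0 by (unfold h; ring).
      replace (phi (f y) - phi (f x) - c * h)
        with (((phi (f y) - phi (f x)) / h - c) * h) by (field; assumption).
      rewrite Rabs_mult. apply Rmult_le_compat_r; [apply Rabs_pos|lra]. }
  replace (phi (f y) - phi (f x) - c * dot d p (vsub y x))
    with ((phi (f y) - phi (f x) - c * h) + c * (h - dot d p (vsub y x))) by ring.
  eapply Rle_trans; [apply Rabs_triang|]. rewrite Rabs_mult.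
  pose proof (dist_nonneg d y x) as Hn.
  assert (T1 : eps / (2 * M) * Rabs h <= eps / 2 * dist d y x).
  { replace (eps / 2 * dist d y x) with (eps / (2 * M) * (M * dist d y x))
      by (field; unfold M; lra).
    apply Rmult_le_compat_l; [lra|exact H1]. }
  assert (T2 : Rabs c * Rabs (h - dot d p (vsub y x)) <= eps / 2 * dist d y x).
  { apply Rle_trans with ((Rabs c + 1) * (eps / (2 * (Rabs c + 1)) * dist d y x)).
    - apply Rmult_le_compat; [lra|apply Rabs_pos|lra|exact H3].
    - apply Req_le. field. lra. }
  lra.
Qed.

Lemma hasD_dist_sqr z x :
  hasD (fun y => dot d (vsub y z) (vsub y z)) x (vscal 2 (vsub x z)).
Proof.
  intros eps Heps. exists eps. split; [exact Heps|]. intros y Hy Hyx.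
  replace (dot d (vsub y z) (vsub y z) - dot d (vsub x z) (vsub x z)
    - dot d (vscal 2 (vsub x z)) (vsub y x)) with (dot d (vsub y x) (vsub y x)).
  - rewrite <- vnorm_sqr. unfold dist in *. pose proof (vnorm_nonneg d (vsub y x)).
    rewrite Rabs_right; nra.
  - rewrite dot_scal_l, !dot_sub_l, !(dot_comm d _ (vsub _ _)), !dot_sub_l.
    rewrite (dot_comm d x y), (dot_comm d x z), (dot_comm d y z). ring.
Qed.

Lemma contV_add g h x : contV g x -> contV h x -> contV (fun y => vadd (g y) (h y)) x.
Proof.
  intros Hg Hh eps Heps.
  destruct (Hg (eps / 2)) as [d1 [Hd1 H1]]; [lra|].
  destruct (Hh (eps / 2)) as [d2 [Hd2 H2]]; [lra|].
  exists (Rmin d1 d2). split; [now apply Rmin_glb_lt|]. intros y Hy Hyx.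
  specialize (H1 y Hy (Rlt_le_trans _ _ _ Hyx (Rmin_l _ _))).
  specialize (H2 y Hy (Rlt_le_trans _ _ _ Hyx (Rmin_r _ _))).
  unfold dist. rewrite (vnorm_ext d _ (vadd (vsub (g y) (g x)) (vsub (h y) (h x))))
    by (intros; unfold vsub, vadd; ring).
  eapply Rle_lt_trans; [apply vnorm_add|]. unfold dist in *. lra.
Qed.

Lemma contV_scal c g x : contR c x -> contV g x -> contV (fun y => vscal (c y) (g y)) x.
Proof.
  intros Hc Hg eps Heps.
  pose proof (vnorm_nonneg d (g x)) as Hn. pose proof (Rabs_pos (c x)) as Hp.
  destruct (Hc (Rmin 1 (eps / (2 * (vnorm d (g x) + 1))))) as [d1 [Hd1 H1]].
  { apply Rmin_glb_lt; [lra|apply Rdiv_lt_0_compat; lra]. }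
  destruct (Hg (eps / (2 * (Rabs (c x) + 1)))) as [d2 [Hd2 H2]];
    [apply Rdiv_lt_0_compat; lra|].
  exists (Rmin d1 d2). split; [now apply Rmin_glb_lt|]. intros y Hy Hyx.
  specialize (H1 y Hy (Rlt_le_trans _ _ _ Hyx (Rmin_l _ _))).
  specialize (H2 y Hy (Rlt_le_trans _ _ _ Hyx (Rmin_r _ _))).
  pose proof (Rlt_le_trans _ _ _ H1 (Rmin_l _ _)) as H3.
  pose proof (Rlt_le_trans _ _ _ H1 (Rmin_r _ _)) as H4.
  unfold dist in *.
  rewrite (vnorm_ext d _ (vadd (vscal (c y) (vsub (g y) (g x))) (vscal (c y - c x) (g x))))
    by (intros; unfold vsub, vadd, vscal; ring).
  eapply Rle_lt_trans; [apply vnorm_add|]. rewrite !vnorm_scal.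
  assert (Hcy : Rabs (c y) <= Rabs (c x) + 1).
  { replace (c y) with (c x + (c y - c x)) by ring.
    eapply Rle_trans; [apply Rabs_triang|]. lra. }
  assert (T1 : Rabs (c y) * vnorm d (vsub (g y) (g x)) <= eps / 2).
  { apply Rle_trans with ((Rabs (c x) + 1) * (eps / (2 * (Rabs (c x) + 1)))).
    - apply Rmult_le_compat; [apply Rabs_pos|apply vnorm_nonneg|lra|lra].
    - apply Req_le. field. lra. }
  assert (T2 : Rabs (c y - c x) * vnorm d (g x) < eps / 2).
  { apply Rle_lt_trans with (eps / (2 * (vnorm d (g x) + 1)) * vnorm d (g x)).
    - apply Rmult_le_compat_r; [exact Hn|lra].
    - apply Rlt_le_trans with (eps / (2 * (vnorm d (g x) + 1)) * (vnorm d (g x) + 1)).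
      + apply Rmult_lt_compat_l; [apply Rdiv_lt_0_compat; lra|lra].
      + apply Req_le. field. lra. }
  lra.
Qed.

Lemma contR_comp f phi x : contR f x -> continuity_pt phi (f x) -> contR (fun y => phi (f y)) x.
Proof.
  intros Hf Hphi eps Heps. destruct (Hphi eps Heps) as [a [Ha H]].
  destruct (Hf a Ha) as [delta [Hd H']]. exists delta. split; [exact Hd|].
  intros y Hy Hyx. specialize (H' y Hy Hyx).
  destruct (Req_dec (f x) (f y)) as [E|E].
  - rewrite E, Rminus_diag, Rabs_R0. exact Heps.
  - apply H. split; [split; [exact I|exact E]|exact H'].
Qed.

Lemma is_C1_deriv_ext f g df :
  (forall y, K y -> f y = g y) -> is_C1_deriv d K f df -> is_C1_deriv d K g df.
Proof.
  rewrite !is_C1_deriv_hasD. intros E H x Hx. destruct (H x Hx) as [H1 H2].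
  split; [exact H1|]. exact (hasD_ext f g x _ Hx E H2).
Qed.

Lemma is_C1_deriv_const c : is_C1_deriv d K (fun _ => c) (fun _ => vzero).
Proof.
  rewrite is_C1_deriv_hasD. intros x Hx. split; [|apply hasD_const].
  intros eps Heps. exists 1. split; [lra|]. intros. now rewrite dist_refl.
Qed.

Lemma is_C1_deriv_add f g df dg : is_C1_deriv d K f df -> is_C1_deriv d K g dg ->
  is_C1_deriv d K (fun y => f y + g y) (fun y => vadd (df y) (dg y)).
Proof.
  rewrite !is_C1_deriv_hasD. intros Hf Hg x Hx.
  destruct (Hf x Hx), (Hg x Hx). split; [now apply contV_add|now apply hasD_add].
Qed.

Lemma is_C1_deriv_comp f df phi dphi : is_C1_deriv d K f df ->
  (forall x, K x -> derivable_pt_lim phi (f x) (dphi (f x))) ->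
  (forall x, K x -> continuity_pt dphi (f x)) ->
  is_C1_deriv d K (fun y => phi (f y)) (fun y => vscal (dphi (f y)) (df y)).
Proof.
  rewrite !is_C1_deriv_hasD. intros Hf H1 H2 x Hx. destruct (Hf x Hx) as [H3 H4]. split.
  - apply (contV_scal (fun y => dphi (f y))); [|exact H3].
    apply contR_comp; [exact (hasD_contR _ _ _ H4)|auto].
  - now apply hasD_comp; auto.
Qed.

Lemma is_C1_deriv_scal c f df : is_C1_deriv d K f df ->
  is_C1_deriv d K (fun y => c * f y) (fun y => vscal c (df y)).
Proof.
  intros Hf. apply (is_C1_deriv_comp f df (fun t => c * t) (fun _ => c) Hf).
  - intros x Hx.
    pose proof (derivable_pt_lim_scal id c (f x) 1 (derivable_pt_lim_id _)) as H.
    now rewrite Rmult_1_r in H.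
  - intros x _. apply continuity_pt_const. now intros a b.
Qed.

Lemma is_C1_deriv_sub f g df dg : is_C1_deriv d K f df -> is_C1_deriv d K g dg ->
  is_C1_deriv d K (fun y => f y - g y) (fun y => vadd (df y) (vscal (-1) (dg y))).
Proof.
  intros Hf Hg.
  apply (is_C1_deriv_ext (fun y => f y + (-1) * g y)); [intros; ring|].
  apply is_C1_deriv_add; [exact Hf|now apply is_C1_deriv_scal].
Qed.

Lemma is_C1_deriv_dist_sqr z :
  is_C1_deriv d K (fun y => dot d (vsub y z) (vsub y z)) (fun y => vscal 2 (vsub y z)).
Proof.
  rewrite is_C1_deriv_hasD. intros x Hx. split; [|apply hasD_dist_sqr].
  intros eps Heps. exists (eps / 2). split; [lra|]. intros y Hy Hyx.
  unfold dist. rewrite (vnorm_ext d _ (vscal 2 (vsub y x)))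
    by (intros; unfold vsub, vscal; ring).
  rewrite vnorm_scal, Rabs_right by lra. unfold dist in Hyx. lra.
Qed.

(* [f] and [df] are bounded by [e] on [K]: up to a factor 2 this is a bound for the C^1 norm. *)
Definition C1_bounded (f : vec -> R) (df : vec -> vec) (e : R) : Prop :=
  is_C1_deriv d K f df /\ forall y, K y -> Rabs (f y) <= e /\ vnorm d (df y) <= e.

Lemma C1_bounded_ext f g df e :
  (forall y, K y -> f y = g y) -> C1_bounded f df e -> C1_bounded g df e.
Proof.
  intros E [H1 H2]. split; [exact (is_C1_deriv_ext f g df E H1)|].
  intros y Hy. rewrite <- (E y Hy). auto.
Qed.

Lemma C1_bounded_add f g df dg a b : C1_bounded f df a -> C1_bounded g dg b ->
  C1_bounded (fun y => f y + g y) (fun y => vadd (df y) (dg y)) (a + b).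
Proof.
  intros [H1 H2] [H3 H4]. split; [now apply is_C1_deriv_add|].
  intros y Hy. destruct (H2 y Hy), (H4 y Hy).
  pose proof (Rabs_triang (f y) (g y)). pose proof (vnorm_add d (df y) (dg y)). lra.
Qed.

Lemma C1_bounded_scal c f df a : C1_bounded f df a ->
  C1_bounded (fun y => c * f y) (fun y => vscal c (df y)) (Rabs c * a).
Proof.
  intros [H1 H2]. split; [now apply is_C1_deriv_scal|].
  intros y Hy. destruct (H2 y Hy). rewrite vnorm_scal, Rabs_mult.
  pose proof (Rabs_pos c). split; apply Rmult_le_compat_l; assumption.
Qed.

(** * Suprema, infima and the C^1 norm *)

Lemma is_supK_nonneg h s : is_supK K h s -> 0 <= s.
Proof. intros [H _]. apply H. now left. Qed.

Lemma is_supK_exists h b : (forall x, K x -> h x <= b) -> 0 <= b ->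
  exists s, is_supK K h s /\ s <= b.
Proof.
  intros Hh Hb.
  assert (Hub : is_upper_bound (fun r => r = 0 \/ exists x, K x /\ r = h x) b).
  { intros r [->|[x [Hx ->]]]; auto. }
  destruct (completeness (fun r => r = 0 \/ exists x, K x /\ r = h x)) as [s Hs].
  - now exists b.
  - exists 0. now left.
  - exists s. split; [exact Hs|now apply Hs].
Qed.

Lemma is_glb_exists (E : R -> Prop) b r0 : (forall r, E r -> b <= r) -> E r0 ->
  exists m, is_glb E m.
Proof.
  intros Hb H0. destruct (completeness (fun r => E (- r))) as [s [Hs1 Hs2]].
  - exists (- b). intros r Hr. specialize (Hb _ Hr). lra.
  - exists (- r0). now rewrite Ropp_involutive.
  - exists (- s). split.
    + intros r Hr. enough (- r <= s) by lra. apply Hs1. now rewrite Ropp_involutive.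
    + intros c Hc. enough (s <= - c) by lra. apply Hs2. intros r Hr.
      specialize (Hc _ Hr). lra.
Qed.

(** The infimum over all derivatives need not be attained; the strict inequality leaves room to
    choose one derivative. Both summands of the norm are nonnegative, so each of them is below
    [e]. *)
Lemma C1norm_lt_bounded f r e : C1norm d K f r -> r < e -> exists df, C1_bounded f df e.
Proof.
  intros [s [t [Hs [[Ht1 Ht2] ->]]]] He.
  pose proof (is_supK_nonneg _ _ Hs) as Hs0.
  assert (Ht0 : 0 <= t).
  { apply Ht2. intros r [df [_ H]]. exact (is_supK_nonneg _ _ H). }
  destruct (classic (exists u, u < e /\ exists df, is_C1_deriv d K f df /\
    is_supK K (fun x => vnorm d (df x)) u)) as [[u [Hu [df [H1 H2]]]]|Hno].
  - exists df. split; [exact H1|]. intros y Hy. split.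
    + assert (Rabs (f y) <= s) by (apply Hs; right; now exists y). lra.
    + assert (vnorm d (df y) <= u) by (apply H2; right; now exists y). lra.
  - exfalso. enough (e <= t) by lra. apply Ht2. intros u Hu.
    destruct (Rle_or_lt e u) as [H|H]; [exact H|]. exfalso. apply Hno. now exists u.
Qed.

Lemma C1_bounded_norm f df e : 0 <= e -> C1_bounded f df e ->
  exists r, C1norm d K f r /\ r <= 2 * e.
Proof.
  intros He [H1 H2].
  destruct (is_supK_exists (fun x => Rabs (f x)) e) as [s [Hs Hse]];
    [intros x Hx; now apply H2|exact He|].
  destruct (is_supK_exists (fun x => vnorm d (df x)) e) as [u [Hu Hue]];
    [intros x Hx; now apply H2|exact He|].
  destruct (is_glb_exists (fun u => exists df, is_C1_deriv d K f df /\
                     is_supK K (fun x => vnorm d (df x)) u) 0 u) as [t Ht].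
  - intros r [df' [_ H]]. exact (is_supK_nonneg _ _ H).
  - now exists df.
  - exists (s + t). split; [now exists s, t|].
    assert (t <= u) by (apply Ht; now exists df). lra.
Qed.

End C1Calculus.

(** * Paths and components *)

Section Paths.
Context (d : nat) (K : vec -> Prop) (HK : in_Rd d K).

Lemma partition_extend a t t' n p : partition a t n p -> t <= t' ->
  partition a t' (S n) (fun j => if le_lt_dec j n then p j else t').
Proof.
  intros [H1 [H2 H3]] Ht. split; [|split].
  - destruct (le_lt_dec 0 n); [exact H1|lia].
  - destruct (le_lt_dec (S n) n); [lia|reflexivity].
  - intros j Hj. destruct (le_lt_dec j n) as [h|h]; [|lia].
    destruct (le_lt_dec (S j) n) as [h'|h']; [apply H3; lia|].
    replace j with n by lia. lra.
Qed.

(** No chain rule is available along a merely rectifiable path. Differentiability of [h] at [g s]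
    does bound the increment of [h] over each short chord ending at [g s] by [M + eta] times that
    chord; a supremum argument in the parameter links such chords into an inscribed polygon, whose
    length is at most [L]. *)
Lemma mean_value_path g a b x y L h dh M :
  path_in d K g a b x y L -> is_C1_deriv d K h dh -> (forall z, K z -> vnorm d (dh z) <= M) ->
  Rabs (h y - h x) <= M * L.
Proof.
  intros [Hab [HgK [Hgc [Hga [Hgb HL]]]]] Hh HM.
  rewrite (is_C1_deriv_hasD d K HK) in Hh.
  assert (HM0 : 0 <= M).
  { apply Rle_trans with (vnorm d (dh (g a))); [apply vnorm_nonneg|].
    apply HM, HgK. lra. }
  set (len := fun n p => sumR n (fun j => dist d (g (p (S j))) (g (p j)))).
  assert (Hlen : forall n p, 0 <= len n p)
    by (intros; apply sumR_nonneg; intros; apply dist_nonneg).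
  assert (HL0 : 0 <= L).
  { apply Rle_trans with (len 1%nat (fun j => match j with O => a | _ => b end)); [apply Hlen|].
    apply HL. split; [reflexivity|split; [reflexivity|]]. intros j Hj.
    replace j with 0%nat by lia. exact Hab. }
  assert (Hmain : forall eta, 0 < eta -> Rabs (h y - h x) <= (M + eta) * L).
  { intros eta Heta.
    (* [E] carries a partition as witness, so it can be extended by one chord without any continuity
       or additivity of arc length. *)
    set (E := fun t => a <= t <= b /\ exists n p, partition a t n p /\
      Rabs (h (g t) - h x) <= (M + eta) * len n p).
    assert (Hext : forall t t', E t -> t <= t' <= b ->
      Rabs (h (g t') - h (g t)) <= (M + eta) * dist d (g t') (g t) -> E t').
    { intros t t' [Ht [n [p [Hp Hn]]]] Ht' Hd. split; [lra|].
      exists (S n), (fun j => if le_lt_dec j n then p j else t').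
      split; [apply (partition_extend a t); [exact Hp|lra]|].
      assert (El : len (S n) (fun j => if le_lt_dec j n then p j else t')
        = len n p + dist d (g t') (g t)).
      { unfold len. cbn [sumR]. f_equal.
        - apply sumR_ext. intros j Hj.
          destruct (le_lt_dec (S j) n); [|lia]. destruct (le_lt_dec j n); [reflexivity|lia].
        - destruct (le_lt_dec (S n) n); [lia|]. destruct (le_lt_dec n n); [|lia].
          destruct Hp as [_ [-> _]]. reflexivity. }
      rewrite El.
      replace (h (g t') - h x) with ((h (g t') - h (g t)) + (h (g t) - h x)) by ring.
      eapply Rle_trans; [apply Rabs_triang|]. lra. }
    assert (Ea : E a).
    { split; [lra|]. exists 0%nat, (fun _ => a). split.
      - split; [reflexivity|split; [reflexivity|]]. intros; lia.
      - rewrite Hga, Rminus_diag, Rabs_R0. change (len 0%nat (fun _ => a)) with 0. lra. }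
    destruct (completeness E) as [s [Hs1 Hs2]].
    { exists b. intros t [Ht _]. lra. }
    { now exists a. }
    assert (Has : a <= s) by now apply Hs1.
    assert (Hsb : s <= b) by (apply Hs2; intros t [Ht _]; lra).
    destruct (hasD_local_lipschitz d K h (g s) (dh (g s))
      (proj2 (Hh (g s) (HgK s (conj Has Hsb)))) eta Heta) as [d0 [Hd0 H0]].
    destruct (Hgc s (conj Has Hsb) d0 Hd0) as [d1 [Hd1 H1]].
    assert (Hloc : forall t, a <= t <= b -> Rabs (t - s) < d1 ->
      Rabs (h (g t) - h (g s)) <= (M + eta) * dist d (g t) (g s)).
    { intros t Ht Hts. eapply Rle_trans; [apply H0; [now apply HgK|now apply H1]|].
      apply Rmult_le_compat_r; [apply dist_nonneg|].
      pose proof (HM (g s) (HgK s (conj Has Hsb))). lra. }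
    (* Some point of [E] lies within [d1] below [s], and the estimate centred at [s] reaches [s]
       from it in one chord. *)
    assert (Es : E s).
    { destruct (classic (exists t, E t /\ s - d1 < t)) as [[t [Ht Hts]]|Hno].
      - assert (t <= s) by now apply Hs1. apply (Hext t s Ht); [lra|].
        rewrite Rabs_minus_sym, dist_sym. destruct Ht as [Ht _]. apply Hloc; [exact Ht|].
        rewrite Rabs_left1; lra.
      - exfalso. enough (s <= s - d1) by lra. apply Hs2. intros t Ht.
        destruct (Rle_or_lt t (s - d1)) as [H|H]; [exact H|].
        exfalso. apply Hno. now exists t. }
    destruct (Rle_lt_or_eq_dec s b Hsb) as [Hlt|Heq].
    - exfalso. set (t := Rmin b (s + d1 / 2)).
      assert (Ht1 : s < t) by (apply Rmin_glb_lt; lra).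
      assert (Ht2 : t <= b) by apply Rmin_l. assert (Ht3 : t <= s + d1 / 2) by apply Rmin_r.
      enough (t <= s) by lra. apply Hs1. apply (Hext s t Es); [lra|].
      apply Hloc; [lra|]. rewrite Rabs_right; lra.
    - subst s. destruct Es as [_ [n [p [Hp Hn]]]]. rewrite Hgb in Hn.
      eapply Rle_trans; [exact Hn|]. apply Rmult_le_compat_l; [lra|]. now apply HL. }
  apply le_epsilon. intros eps Heps.
  eapply Rle_trans; [apply (Hmain (eps / (L + 1))); apply Rdiv_lt_0_compat; lra|].
  rewrite Rmult_plus_distr_r. apply Rplus_le_compat_l.
  apply Rle_trans with (eps / (L + 1) * (L + 1)).
  - apply Rmult_le_compat_l; [apply Rlt_le, Rdiv_lt_0_compat; lra|lra].
  - apply Req_le. field. lra.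
Qed.

(** * Connected components *)

Lemma connected_singleton x : connected d (eq x).
Proof.
  intros U V _ _ HUV _. destruct (HUV x eq_refl) as [H|H];
    [left|right]; now intros ? <-.
Qed.

Lemma connected_union C1 C2 z : connected d C1 -> connected d C2 -> C1 z -> C2 z ->
  connected d (fun w => C1 w \/ C2 w).
Proof.
  intros H1 H2 Hz1 Hz2 U V HU HV HUV Hdis.
  destruct (H1 U V HU HV) as [h1|h1];
    [intros; apply HUV; auto|intros x Hx; apply Hdis; auto| |];
  (destruct (H2 U V HU HV) as [h2|h2];
    [intros; apply HUV; auto|intros x Hx; apply Hdis; auto| |]).
  - left. intros x [Hx|Hx]; auto.
  - exfalso. apply (Hdis z); auto.
  - exfalso. apply (Hdis z); auto.
  - right. intros x [Hx|Hx]; auto.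
Qed.

Lemma connected_limit_point C x : connected d C -> (exists z, C z) ->
  (forall r, 0 < r -> exists z, C z /\ dist d z x < r) ->
  connected d (fun w => C w \/ w = x).
Proof.
  intros HC [z0 Hz0] Hlim U V HU HV HUV Hdis.
  assert (Haux : forall A B : vec -> Prop, open_set d B -> (A x \/ B x) ->
    (forall w, C w -> A w -> B w -> False) -> (forall w, C w -> A w) ->
    forall w, C w \/ w = x -> A w).
  { intros A B HB HAB Hd HA w [Hw| ->]; [auto|].
    destruct HAB as [H|H]; [exact H|]. exfalso. destruct (HB x H) as [r [Hr Hr']].
    destruct (Hlim r Hr) as [z [Hz Hzx]]. apply (Hd z); auto. }
  destruct (HC U V HU HV) as [h|h];
    [intros; apply HUV; auto|intros w Hw; apply Hdis; auto| |].
  - left. apply (Haux U V HV); auto. intros w Hw; apply Hdis; auto.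
  - right. apply (Haux V U HU); auto.
    + destruct (HUV x); auto.
    + intros w Hw H1 H2. apply (Hdis w); auto.
Qed.

Lemma component_refl x : K x -> component d K x x.
Proof.
  intros Hx. exists (eq x). split; [now intros z <-|].
  split; [apply connected_singleton|now split].
Qed.

Lemma component_sym x y : component d K x y -> component d K y x.
Proof. intros [C [H1 [H2 [H3 H4]]]]. now exists C. Qed.

Lemma component_trans x y z : component d K x y -> component d K y z -> component d K x z.
Proof.
  intros [C [H1 [H2 [H3 H4]]]] [C' [H1' [H2' [H3' H4']]]].
  exists (fun w => C w \/ C' w). split; [intros w [Hw|Hw]; auto|].
  split; [now apply (connected_union C C' y)|auto].
Qed.

Lemma component_subset x y : component d K x y -> K y.
Proof. intros [C [H1 [H2 [H3 H4]]]]. auto. Qed.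

Lemma component_closed x y : K y ->
  (forall r, 0 < r -> exists z, component d K x z /\ dist d z y < r) -> component d K x y.
Proof.
  intros Hy Hlim.
  assert (Hcomp : connected d (component d K x)).
  { intros U V HU HV HUV Hdis.
    (* If some [w] misses [U], every [z] shares with [w] a connected set, which must then lie in
       [V]. *)
    destruct (classic (exists w, component d K x w /\ ~ U w)) as [[w [Hw HwU]]|H].
    - right. intros z Hz.
      destruct (component_trans w x z (component_sym _ _ Hw) Hz) as [C [H1 [H2 [H3 H4]]]].
      assert (HCx : forall v, C v -> component d K x v).
      { intros v Hv. apply (component_trans x w v Hw). now exists C. }
      destruct (H2 U V HU HV) as [h|h]; auto.
      + intros v Hv. apply Hdis; auto.
      + exfalso. auto.
    - left. intros w Hw. apply NNPP. intros HwU. apply H. now exists w. }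
  destruct (Hlim 1 Rlt_0_1) as [z [Hz _]].
  exists (fun w => component d K x w \/ w = y). split; [|split; [|split]].
  - intros w [Hw| ->]; [exact (component_subset x w Hw)|exact Hy].
  - apply connected_limit_point; [exact Hcomp|now exists z|exact Hlim].
  - left. destruct Hz as [C [H1 [H2 [H3 H4]]]]. apply component_refl. auto.
  - now right.
Qed.

(** Components are closed, so each listed component that does not contain [x] keeps a positive
    distance from it; the minimum over the finite list remains positive. *)
Lemma component_open : finitely_many_components d K -> forall x, K x ->
  exists r, 0 < r /\ forall y, K y -> dist d y x < r -> component d K x y.
Proof.
  intros [l [_ Hl]] x Hx.
  assert (H : exists r, 0 < r /\ forall c y, In c l -> component d K c y ->
    dist d y x < r -> component d K c x).
  { clear Hl. induction l as [|c l [r [Hr IH]]].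
    - exists 1. split; [lra|]. intros c y [].
    - destruct (classic (component d K c x)) as [Hc|Hc].
      + exists r. split; [exact Hr|]. intros c' y [<-|Hc'] H1 H2; [exact Hc|eauto].
      + destruct (classic (exists r', 0 < r' /\ forall z, component d K c z -> r' <= dist d z x))
          as [[r' [Hr' H']]|Hno].
        * exists (Rmin r r'). split; [now apply Rmin_glb_lt|].
          intros c' y [<-|Hc'] H1 H2.
          -- specialize (H' y H1). pose proof (Rmin_r r r'). lra.
          -- apply (IH c' y Hc' H1). pose proof (Rmin_l r r'). lra.
        * exfalso. apply Hc, component_closed; [exact Hx|]. intros r' Hr'.
          apply NNPP. intros Hz. apply Hno. exists r'. split; [exact Hr'|].
          intros z Hz'. destruct (Rle_or_lt r' (dist d z x)) as [h|h]; [exact h|].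
          exfalso. apply Hz. now exists z. }
  destruct H as [r [Hr H]]. exists r. split; [exact Hr|]. intros y Hy Hyx.
  destruct (Hl y Hy) as [c [Hc Hcy]].
  apply (component_trans x c y); [apply component_sym; eauto|exact Hcy].
Qed.

(** The connectedness of an interval, carried out on parameters: [Haux] shows that the open set
    containing the starting point is never left. It is stated for [A] and [B] because either of [U]
    and [V] may contain that point. *)
Lemma path_image_connected P g a b x y L : path_in d P g a b x y L ->
  connected d (fun w => exists t, a <= t <= b /\ w = g t).
Proof.
  intros [Hab [HgK [Hgc _]]] U V HU HV HUV Hdis.
  assert (Haux : forall A B : vec -> Prop, open_set d A -> open_set d B -> A (g a) ->
    (forall t, a <= t <= b -> A (g t) \/ B (g t)) ->
    (forall t, a <= t <= b -> A (g t) -> B (g t) -> False) ->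
    forall t, a <= t <= b -> A (g t)).
  { intros A B HA HB HAa HAB Hd t Ht.
    set (E := fun s => a <= s <= t /\ forall s', a <= s' <= s -> A (g s')).
    destruct (completeness E) as [s [Hs1 Hs2]].
    { exists t. intros s [Hs _]. lra. }
    { exists a. split; [lra|]. intros s' Hs'. replace s' with a by lra. exact HAa. }
    assert (Has : a <= s).
    { apply Hs1. split; [lra|]. intros s' Hs'. replace s' with a by lra. exact HAa. }
    assert (Hst : s <= t) by (apply Hs2; intros s' [Hs' _]; lra).
    assert (Hloc : forall W, open_set d W -> W (g s) -> exists e, 0 < e /\
      forall s', a <= s' <= b -> Rabs (s' - s) < e -> W (g s')).
    { intros W HW HWs. destruct (HW _ HWs) as [r [Hr Hr']].
      destruct (Hgc s ltac:(lra) r Hr) as [e [He He']]. exists e. split; [exact He|].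
      intros s' Hs' Hss. apply Hr'. now apply He'. }
    assert (Hbelow : forall s', a <= s' < s -> A (g s')).
    { intros s' Hs'. apply NNPP. intros HnA. enough (s <= s') by lra. apply Hs2.
      intros v [Hv1 Hv2]. destruct (Rle_or_lt v s') as [h|h]; [exact h|].
      exfalso. apply HnA, Hv2. lra. }
    assert (HAs : A (g s)).
    { destruct (HAB s ltac:(lra)) as [h|h]; [exact h|]. exfalso.
      destruct (Hloc B HB h) as [e [He He']].
      destruct (Rle_lt_or_eq_dec a s Has) as [Hlt|<-].
      - set (v := Rmax a (s - e / 2)).
        assert (a <= v) by apply Rmax_l. assert (s - e / 2 <= v) by apply Rmax_r.
        assert (v < s) by (apply Rmax_lub_lt; lra).
        apply (Hd v); [lra|apply Hbelow; lra|]. apply He'; [lra|]. rewrite Rabs_left; lra.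
      - apply (Hd a); auto; lra. }
    destruct (Rle_lt_or_eq_dec s t Hst) as [Hlt|<-]; [|exact HAs]. exfalso.
    destruct (Hloc A HA HAs) as [e [He He']].
    set (v := Rmin t (s + e / 2)).
    assert (s < v) by (apply Rmin_glb_lt; lra).
    assert (v <= t) by apply Rmin_l. assert (v <= s + e / 2) by apply Rmin_r.
    enough (v <= s) by lra. apply Hs1. split; [lra|]. intros s' Hs'.
    destruct (Rlt_or_le s' s) as [h|h]; [apply Hbelow; lra|].
    apply He'; [lra|]. rewrite Rabs_right; lra. }
  assert (HUV' : forall t, a <= t <= b -> U (g t) \/ V (g t))
    by (intros t Ht; apply HUV; now exists t).
  assert (Hdis' : forall t, a <= t <= b -> U (g t) -> V (g t) -> False)
    by (intros t Ht; apply Hdis; now exists t).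
  destruct (HUV' a ltac:(lra)) as [h|h].
  - left. intros w [t [Ht ->]]. now apply (Haux U V).
  - right. intros w [t [Ht ->]]. apply (Haux V U); auto.
    + intros s Hs. destruct (HUV' s Hs); auto.
    + intros s Hs H1 H2. apply (Hdis' s); auto.
Qed.

(** The image of the path is itself a connected subset of [K] through [x], so paths found in [K]
    serve the component as well. *)
Lemma path_in_component g a b x y L : path_in d K g a b x y L ->
  path_in d (component d K x) g a b x y L.
Proof.
  intros Hp. pose proof (path_image_connected K g a b x y L Hp) as Hc.
  destruct Hp as [Hab [HgK [Hgc [Hga Hr]]]].
  split; [exact Hab|split; [|split; [exact Hgc|split; [exact Hga|exact Hr]]]].
  intros t Ht. exists (fun w => exists t, a <= t <= b /\ w = g t).
  split; [intros z [s [Hs ->]]; auto|]. split; [exact Hc|]. split.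
  - exists a. split; [lra|now symmetry].
  - now exists t.
Qed.

Lemma path_in_subset (P Q : vec -> Prop) g a b x y L : (forall z, P z -> Q z) ->
  path_in d P g a b x y L -> path_in d Q g a b x y L.
Proof.
  intros H [Hab [HgK Hr]]. split; [exact Hab|split; [|exact Hr]]. auto.
Qed.

End Paths.

(** * Completeness from short paths *)

Lemma Rabs_sub_le a b : Rabs (a - b) <= Rabs a + Rabs b.
Proof. rewrite <- (Rabs_Ropp b). apply Rabs_triang. Qed.

Lemma pow_small q c eps : 0 <= q < 1 -> 0 < c -> 0 < eps ->
  exists N, forall k, (N <= k)%nat -> c * q ^ k < eps.
Proof.
  intros Hq Hc Heps. destruct (pow_lt_1_zero q ltac:(rewrite Rabs_right; lra) (eps / c))
    as [N HN]; [now apply Rdiv_lt_0_compat|]. exists N. intros k Hk.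
  specialize (HN k Hk). pose proof (Rle_abs (q ^ k)).
  apply (Rmult_lt_reg_r (/ c)); [now apply Rinv_0_lt_compat|].
  replace (c * q ^ k * / c) with (q ^ k) by (field; lra). unfold Rdiv in HN. lra.
Qed.

(** Lets the lemmas on Cauchy sequences of vectors serve for real values, as vectors of dimension
    1. *)
Lemma dist_1 a b : dist 1 (fun _ => a) (fun _ => b) = Rabs (a - b).
Proof.
  unfold dist, vnorm, dot, vsub. cbn [sumR]. rewrite Rplus_0_l. apply sqrt_Rsqr_abs.
Qed.

Lemma dist_geometric d (u : nat -> vec) :
  (forall k, dist d (u (S k)) (u k) <= (/ 2) ^ k) ->
  forall k l, (k <= l)%nat -> dist d (u l) (u k) <= 2 * (/ 2) ^ k.
Proof.
  intros H k l Hl.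
  (* The subtracted tail is what makes the induction on [l] close. *)
  enough (dist d (u l) (u k) <= 2 * (/ 2) ^ k - 2 * (/ 2) ^ l)
    by (pose proof (pow_lt (/ 2) l); lra).
  induction Hl as [|l Hl IH]; [rewrite dist_refl; lra|].
  pose proof (dist_triangle d (u (S l)) (u l) (u k)). specialize (H l). simpl. lra.
Qed.

Section Sufficiency.
Context (d : nat) (K : vec -> Prop) (HK : in_Rd d K).

(** The mean value inequality on a path from [x] to [y] bounds the increment of [f l - f k] by
    [e k * (C * dist d x y)] for all later [l], hence also that of [F - f k]. This is linear in the
    distance, so replacing [F] by a fixed [f k] changes the difference quotient little. All paths
    start at [x], which is why regularity at single points suffices. *)
Lemma hasD_uniform_limit (f : nat -> vec -> R) (D : nat -> vec -> vec) F DF (e : nat -> R) x :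
  (forall eps, 0 < eps -> exists k, e k < eps) ->
  (forall k, is_C1_deriv d K (f k) (D k)) ->
  (forall y k, K y -> Rabs (F y - f k y) <= e k) ->
  (forall y k, K y -> dist d (DF y) (D k y) <= e k) ->
  (forall y k l, K y -> (k <= l)%nat -> dist d (D l y) (D k y) <= e k) ->
  (forall k l, (k <= l)%nat -> e l <= e k) ->
  K x ->
  (exists r C, 0 < r /\ 0 < C /\ forall y, K y -> dist d y x < r ->
     exists g a b, path_in d K g a b x y (C * dist d x y)) ->
  hasD d K F x (DF x).
Proof.
  intros He HD HF HDF HDD Hdec Hx [r [C [Hr [HC Hpath]]]] eps Heps.
  (* In [C + 1], the [C] pays for [F - f k] and the 1 for replacing [DF x] by [D k x]. *)
  destruct (He (eps / (2 * (C + 1)))) as [k Hk]; [apply Rdiv_lt_0_compat; lra|].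
  assert (Hk' : e k * (C + 1) <= eps / 2).
  { apply Rle_trans with (eps / (2 * (C + 1)) * (C + 1)).
    - apply Rmult_le_compat_r; lra.
    - apply Req_le. field. lra. }
  pose proof (proj1 (is_C1_deriv_hasD d K HK _ _) (HD k) x Hx) as [_ Hfk].
  destruct (Hfk (eps / 2)) as [d0 [Hd0 H0]]; [lra|].
  exists (Rmin r d0). split; [now apply Rmin_glb_lt|]. intros y Hy Hyx.
  specialize (H0 y Hy (Rlt_le_trans _ _ _ Hyx (Rmin_r _ _))).
  destruct (Hpath y Hy (Rlt_le_trans _ _ _ Hyx (Rmin_l _ _))) as [g [a [b Hg]]].
  assert (Hmv : forall l, (k <= l)%nat ->
    Rabs ((f l y - f k y) - (f l x - f k x)) <= e k * (C * dist d x y)).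
  { intros l Hl.
    apply (mean_value_path d K HK g a b x y (C * dist d x y) (fun z => f l z - f k z)
      (fun z => vadd (D l z) (vscal (-1) (D k z)))); [exact Hg|now apply is_C1_deriv_sub|].
    intros z Hz. rewrite (vnorm_ext d _ (vsub (D l z) (D k z)))
      by (intros; unfold vadd, vscal, vsub; ring). now apply HDD. }
  assert (Hlim : Rabs ((F y - f k y) - (F x - f k x)) <= e k * (C * dist d x y)).
  { apply le_epsilon. intros eta Heta. destruct (He (eta / 2)) as [l Hl]; [lra|].
    set (m := max k l). specialize (Hmv m ltac:(lia)).
    pose proof (Hdec l m ltac:(lia)). pose proof (HF y m Hy). pose proof (HF x m Hx).
    replace (F y - f k y - (F x - f k x)) with
      ((f m y - f k y - (f m x - f k x)) + ((F y - f m y) - (F x - f m x))) by ring.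
    eapply Rle_trans; [apply Rabs_triang|].
    pose proof (Rabs_sub_le (F y - f m y) (F x - f m x)). lra. }
  pose proof (Cauchy_Schwarz d (vsub (D k x) (DF x)) (vsub y x)) as Hcs.
  rewrite dot_sub_l in Hcs.
  pose proof (HDF x k Hx) as Hdk. rewrite dist_sym in Hdk.
  pose proof (dist_nonneg d y x) as Hn. rewrite (dist_sym d x y) in Hlim.
  assert (Hcs' : Rabs (dot d (D k x) (vsub y x) - dot d (DF x) (vsub y x)) <= e k * dist d y x).
  { eapply Rle_trans; [exact Hcs|]. apply Rmult_le_compat_r; [exact Hn|exact Hdk]. }
  replace (F y - F x - dot d (DF x) (vsub y x)) with
    ((F y - f k y - (F x - f k x)) + (f k y - f k x - dot d (D k x) (vsub y x))
      + (dot d (D k x) (vsub y x) - dot d (DF x) (vsub y x))) by ring.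
  eapply Rle_trans; [apply Rabs_triang|].
  eapply Rle_trans; [apply Rplus_le_compat_r, Rabs_triang|].
  assert (e k * (C + 1) * dist d y x <= eps / 2 * dist d y x)
    by (apply Rmult_le_compat_r; assumption).
  nra.
Qed.

Lemma C1_complete_of_local_paths :
  (forall x, K x -> exists r C, 0 < r /\ 0 < C /\ forall y, K y -> dist d y x < r ->
     exists g a b, path_in d K g a b x y (C * dist d x y)) ->
  C1_complete d K.
Proof.
  intros Hpath f Hf HC.
  assert (HN : forall k, exists N, forall m n, (N <= m)%nat -> (N <= n)%nat ->
    exists df, C1_bounded d K (fsub (f m) (f n)) df ((/ 2) ^ k)).
  { intros k. destruct (HC ((/ 2) ^ k)) as [N HN]; [apply pow_lt; lra|]. exists N.
    intros m n Hm Hn. destruct (HN m n Hm Hn) as [r [Hr Hr']].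
    exact (C1norm_lt_bounded d K _ r _ Hr Hr'). }
  apply functional_choice in HN as [N HN].
  (* A nondecreasing choice of indices, so that [nn k] and [nn (S k)] both lie beyond [N k]. *)
  set (nn := fix nn k := match k with O => N O | S j => max (nn j) (N (S j)) end).
  assert (Hnn : forall k, (N k <= nn k)%nat) by (intros [|k]; simpl; lia).
  assert (HnnS : forall k, (nn k <= nn (S k))%nat) by (intros k; simpl; lia).
  assert (Hg : forall k, exists g,
    C1_bounded d K (fsub (f (nn (S k))) (f (nn k))) g ((/ 2) ^ k)).
  { intros k. specialize (Hnn k). specialize (HnnS k). apply HN; lia. }
  apply functional_choice in Hg as [g Hg].
  destruct (Hf (nn O)) as [D0 HD0].
  (* Arbitrary derivatives of the [f (nn k)] need not converge. Adding up the small derivatives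
     [g j] of the differences yields derivatives that do. *)
  set (D := fix D k y := match k with O => D0 y | S j => vadd (D j y) (g j y) end).
  assert (HD : forall k, is_C1_deriv d K (f (nn k)) (D k)).
  { induction k as [|k IH]; [exact HD0|].
    apply (is_C1_deriv_ext d K HK (fun y => f (nn k) y + fsub (f (nn (S k))) (f (nn k)) y)).
    - intros y Hy. unfold fsub. ring.
    - exact (is_C1_deriv_add d K HK _ _ _ _ IH (proj1 (Hg k))). }
  set (e := fun k => 2 * (/ 2) ^ k).
  assert (He : forall eps, 0 < eps -> exists k, e k < eps).
  { intros eps Heps. destruct (pow_small (/ 2) 2 eps) as [k Hk]; try lra.
    exists k. now apply Hk. }
  assert (He0 : forall k, 0 < (/ 2) ^ k) by (intros; apply pow_lt; lra).
  assert (Hdec : forall k l, (k <= l)%nat -> e l <= e k).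
  { intros k l Hl. induction Hl as [|l Hl IH]; [lra|].
    unfold e in *. specialize (He0 l). simpl. lra. }
  assert (HDD : forall y k l, K y -> (k <= l)%nat -> dist d (D l y) (D k y) <= e k).
  { intros y k l Hy Hl. apply (dist_geometric d (fun k => D k y)); [|exact Hl].
    intros j. unfold dist. simpl.
    rewrite (vnorm_ext d _ (g j y)) by (intros; unfold vsub, vadd; ring). now apply Hg. }
  assert (HDF : forall y, exists Dy, K y -> forall k, dist d Dy (D k y) <= e k).
  { intros y. destruct (classic (K y)) as [Hy|Hy]; [|exists vzero; tauto].
    destruct (cauchy_vec_limit d (fun k => D k y) e He) as [Dy HDy]; [auto|]. now exists Dy. }
  apply functional_choice in HDF as [DF HDF].
  assert (HF : forall y, exists Fy, K y -> forall k, Rabs (Fy - f (nn k) y) <= e k).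
  { intros y. destruct (classic (K y)) as [Hy|Hy]; [|exists 0; tauto].
    destruct (cauchy_vec_limit 1 (fun k _ => f (nn k) y) e He) as [v Hv].
    - intros k l Hl. apply (dist_geometric 1 (fun k _ => f (nn k) y)); [|exact Hl].
      intros j. rewrite dist_1. apply (proj2 (Hg j) y Hy).
    - exists (v O). intros _ k. rewrite <- dist_1.
      eapply Rle_trans; [|apply (Hv k)]. apply Req_le, vnorm_ext. intros i Hi.
      unfold vsub. now replace i with O by lia. }
  apply functional_choice in HF as [F HF].
  assert (HFD : is_C1_deriv d K F DF).
  { apply (is_C1_deriv_hasD d K HK). intros x Hx. split.
    - intros eps Heps. destruct (He (eps / 3)) as [k Hk]; [lra|].
      pose proof (proj1 (is_C1_deriv_hasD d K HK _ _) (HD k) x Hx) as [Hc _].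
      destruct (Hc (eps / 3)) as [delta [Hd H]]; [lra|].
      exists delta. split; [exact Hd|]. intros y Hy Hyx. specialize (H y Hy Hyx).
      pose proof (HDF y Hy k). pose proof (HDF x Hx k) as H2.
      rewrite dist_sym in H2.
      pose proof (dist_triangle d (DF y) (D k y) (DF x)).
      pose proof (dist_triangle d (D k y) (D k x) (DF x)). lra.
    - apply (hasD_uniform_limit (fun k => f (nn k)) D F DF e); auto. }
  exists F. split; [now exists DF|]. intros eps Heps.
  (* The bound [(/ 2) ^ k + e k], which is [3 / 2 * e k], is doubled on passing to the norm; hence
     [eps / 3]. *)
  destruct (He (eps / 3)) as [k Hk]; [lra|]. exists (nn k). intros n Hn.
  destruct (HN k n (nn k)) as [dg Hdg]; [specialize (Hnn k); lia|apply Hnn|].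
  destruct (C1_bounded_norm d K (fsub (f n) F)
    (fun y => vadd (dg y) (vadd (D k y) (vscal (-1) (DF y)))) ((/ 2) ^ k + e k)) as [r [Hr Hr']].
  - unfold e. specialize (He0 k). lra.
  - apply (C1_bounded_ext d K HK (fun y => fsub (f n) (f (nn k)) y + (f (nn k) y - F y)));
      [intros; unfold fsub; ring|].
    apply C1_bounded_add; [exact HK|exact Hdg|]. split; [now apply is_C1_deriv_sub|].
    intros y Hy. rewrite Rabs_minus_sym. split; [auto|].
    rewrite (vnorm_ext d _ (vsub (D k y) (DF y)))
      by (intros; unfold vadd, vscal, vsub; ring).
    specialize (HDF y Hy k). now rewrite dist_sym in HDF.
  - exists r. split; [exact Hr|]. unfold e in *. lra.
Qed.

Lemma C1_complete_of_Whitney_regular : finitely_many_components d K ->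
  (forall x, K x -> pointwise_Whitney_regular d (component d K x)) -> C1_complete d K.
Proof.
  intros Hfin HW. apply C1_complete_of_local_paths. intros x Hx.
  destruct (component_open d K Hfin x Hx) as [r [Hr Hopen]].
  destruct (HW x Hx x (component_refl d K x Hx)) as [r' [C [Hr' [HC Hp]]]].
  exists (Rmin r r'), C. split; [now apply Rmin_glb_lt|]. split; [exact HC|].
  intros y Hy Hyx.
  destruct (Hp y (Hopen y Hy (Rlt_le_trans _ _ _ Hyx (Rmin_l _ _)))
    (Rlt_le_trans _ _ _ Hyx (Rmin_r _ _))) as [g [a [b Hg]]].
  exists g, a, b. revert Hg. apply path_in_subset. apply component_subset.
Qed.

End Sufficiency.

(** * Uniform boundedness *)

Section UniformBoundedness.
Context (d : nat) (K : vec -> Prop) (HK : in_Rd d K).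

(* The uniform boundedness principle for the functionals [f |-> f y - f x], by a gliding hump:
   [nu k] is the norm of the k-th functional, and the signs of the terms [f k / 3^k] are chosen
   so that no term cancels the preceding partial sum. *)
Lemma C1_complete_uniform_lipschitz : C1_complete d K -> forall x, K x ->
  exists C, 0 < C /\ forall f df, C1_bounded d K f df 1 ->
    forall y, K y -> Rabs (f y - f x) <= C * dist d y x.
Proof.
  intros Hcomp x Hx. apply NNPP. intros Hno.
  assert (Hhump : forall k : nat, exists t : vec * (vec -> R) * (vec -> vec) * R,
    let '(y, f, df, nu) := t in K y /\ C1_bounded d K f df 1 /\
    (forall h dh, C1_bounded d K h dh 1 -> Rabs (h y - h x) <= nu) /\
    2 / 3 * nu <= Rabs (f y - f x) /\ dist d y x < (/ 4) ^ k * nu).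
  { intros k. assert (H4 : 0 < 4 ^ k) by (apply pow_lt; lra).
    assert (Hy : exists f df y, C1_bounded d K f df 1 /\ K y /\
      4 ^ k * dist d y x < Rabs (f y - f x)).
    { apply NNPP. intros H. apply Hno. exists (4 ^ k). split; [exact H4|].
      intros f df Hf y Hy. apply Rnot_lt_le. intros H'. apply H. now exists f, df, y. }
    destruct Hy as [f0 [df0 [y [Hf0 [Hy Hlt]]]]].
    (* The supremum over the unit ball may have no maximiser, so [f k] is only asked to reach two
       thirds of it. *)
    set (E := fun r => exists h dh, C1_bounded d K h dh 1 /\ r = Rabs (h y - h x)).
    destruct (completeness E) as [nu [Hnu1 Hnu2]].
    { exists 2. intros r [h [dh [Hh ->]]].
      pose proof (Rabs_sub_le (h y) (h x)).
      pose proof (proj1 (proj2 Hh y Hy)). pose proof (proj1 (proj2 Hh x Hx)). lra. }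
    { exists (Rabs (f0 y - f0 x)), f0, df0. now split. }
    assert (Hnu : Rabs (f0 y - f0 x) <= nu) by (apply Hnu1; now exists f0, df0).
    pose proof (dist_nonneg d y x) as Hd0.
    assert (Hnu0 : 0 < nu) by nra.
    destruct (classic (exists h dh, C1_bounded d K h dh 1 /\ 2 / 3 * nu <= Rabs (h y - h x)))
      as [[h [dh [Hh Hhnu]]]|H].
    - exists (y, h, dh, nu). split; [exact Hy|]. split; [exact Hh|]. split; [|split].
      + intros h' dh' Hh'. apply Hnu1. now exists h', dh'.
      + exact Hhnu.
      + replace (dist d y x) with ((/ 4) ^ k * (4 ^ k * dist d y x)).
        * apply Rmult_lt_compat_l; [apply pow_lt|]; lra.
        * rewrite <- Rmult_assoc, <- Rpow_mult_distr, Rinv_l, pow1 by lra. ring.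
    - exfalso. enough (nu <= 2 / 3 * nu) by lra. apply Hnu2. intros r [h [dh [Hh ->]]].
      apply Rnot_lt_le. intros H'. apply H. exists h, dh. split; [exact Hh|lra]. }
  apply functional_choice in Hhump as [T HT].
  set (y := fun k => let '(y, _, _, _) := T k in y).
  set (f := fun k => let '(_, f, _, _) := T k in f).
  set (df := fun k => let '(_, _, df, _) := T k in df).
  set (nu := fun k => let '(_, _, _, nu) := T k in nu).
  assert (HT' : forall k, K (y k) /\ C1_bounded d K (f k) (df k) 1 /\
    (forall h dh, C1_bounded d K h dh 1 -> Rabs (h (y k) - h x) <= nu k) /\
    2 / 3 * nu k <= Rabs (f k (y k) - f k x) /\ dist d (y k) x < (/ 4) ^ k * nu k).
  { intros k. specialize (HT k). unfold y, f, df, nu.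
    destruct (T k) as [[[y0 f0] df0] nu0]. exact HT. }
  clearbody y f df nu. clear HT T.
  set (sgn := fun k (a : vec -> R) =>
    if Rle_dec 0 ((a (y k) - a x) * (f k (y k) - f k x)) then (/ 3) ^ k else - (/ 3) ^ k).
  set (s := fix s k : vec -> R :=
    match k with O => fun _ => 0 | S j => fun z => s j z + sgn j (s j) * f j z end).
  assert (H3 : forall k, 0 < (/ 3) ^ k) by (intros; apply pow_lt; lra).
  assert (Hsgn : forall k a, Rabs (sgn k a) = (/ 3) ^ k).
  { intros k a. specialize (H3 k). unfold sgn. destruct (Rle_dec _ _).
    - apply Rabs_right. lra.
    - rewrite Rabs_Ropp. apply Rabs_right. lra. }
  assert (Hgrow : forall k, (/ 3) ^ k * (2 / 3 * nu k) <= Rabs (s (S k) (y k) - s (S k) x)).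
  { intros k. destruct (HT' k) as [_ [_ [_ [Hk _]]]].
    set (b := f k (y k) - f k x) in *. set (a := s k (y k) - s k x).
    replace (s (S k) (y k) - s (S k) x) with (a + sgn k (s k) * b)
      by (unfold a, b; simpl; ring).
    apply Rle_trans with ((/ 3) ^ k * Rabs b);
      [apply Rmult_le_compat_l; [specialize (H3 k); lra|exact Hk]|].
    rewrite <- (Hsgn k (s k)), <- Rabs_mult.
    apply Rsqr_le_abs_0. unfold Rsqr.
    assert (0 <= a * (sgn k (s k) * b)).
    { specialize (H3 k). unfold sgn. fold a b. destruct (Rle_dec 0 (a * b)); nra. }
    nra. }
  (* The bound is the exact geometric sum of [(/ 3) ^ j] over [k <= j < l]. *)
  assert (Hdiff : forall k l, (k <= l)%nat -> exists dh,
    C1_bounded d K (fun z => s l z - s k z) dh (3 / 2 * ((/ 3) ^ k - (/ 3) ^ l))).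
  { intros k l Hl. induction Hl as [|l Hl [dh IH]].
    - exists (fun _ => vzero). apply (C1_bounded_ext d K HK (fun _ => 0)); [intros; ring|].
      split; [now apply is_C1_deriv_const|]. intros z Hz. rewrite Rabs_R0, vnorm_zero. lra.
    - exists (fun z => vadd (dh z) (vscal (sgn l (s l)) (df l z))).
      apply (C1_bounded_ext d K HK (fun z => (s l z - s k z) + sgn l (s l) * f l z));
        [intros; simpl; ring|].
      replace (3 / 2 * ((/ 3) ^ k - (/ 3) ^ S l))
        with (3 / 2 * ((/ 3) ^ k - (/ 3) ^ l) + Rabs (sgn l (s l)) * 1)
        by (rewrite Hsgn; simpl; lra).
      apply C1_bounded_add; [exact HK|exact IH|]. apply C1_bounded_scal; [exact HK|].
      apply HT'. }
  destruct (Hcomp s) as [g [Hg Hconv]].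
  { intros n. destruct (Hdiff O n ltac:(lia)) as [dh [Hdh _]]. exists dh.
    revert Hdh. apply is_C1_deriv_ext; [exact HK|]. intros; simpl; ring. }
  { intros eps Heps. destruct (pow_small (/ 3) 3 eps) as [N HN]; try lra.
    exists N. intros m n Hm Hn.
    assert (Hmn : exists dh, C1_bounded d K (fsub (s m) (s n)) dh (3 / 2 * (/ 3) ^ N)).
    { assert (Hle : forall k l, (N <= k)%nat -> (k <= l)%nat ->
        3 / 2 * ((/ 3) ^ k - (/ 3) ^ l) <= 3 / 2 * (/ 3) ^ N).
      { intros k l Hk _. pose proof (H3 l).
        enough ((/ 3) ^ k <= (/ 3) ^ N) by lra.
        clear - Hk. induction Hk; [lra|]. simpl.
        assert (0 < (/ 3) ^ m) by (apply pow_lt; lra). lra. }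
      destruct (Nat.le_ge_cases m n) as [Hmn|Hmn].
      - destruct (Hdiff m n Hmn) as [dh Hdh].
        exists (fun z => vscal (-1) (dh z)).
        apply (C1_bounded_ext d K HK (fun z => (-1) * (s n z - s m z)));
          [intros; unfold fsub; ring|].
        destruct (C1_bounded_scal d K HK (-1) _ _ _ Hdh) as [H1 H2].
        split; [exact H1|]. intros z Hz. destruct (H2 z Hz) as [H5 H6].
        specialize (Hle m n Hm Hmn).
        assert (Rabs (-1) = 1) as E by (rewrite Rabs_left; lra). rewrite E in H5, H6. lra.
      - destruct (Hdiff n m Hmn) as [dh [H1 H2]]. exists dh. split; [exact H1|].
        intros z Hz. destruct (H2 z Hz) as [H5 H6]. specialize (Hle n m Hn Hmn).
        unfold fsub. lra. }
    destruct Hmn as [dh Hdh]. pose proof (H3 N).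
    destruct (C1_bounded_norm d K _ dh (3 / 2 * (/ 3) ^ N) ltac:(lra) Hdh) as [r [Hr Hr']].
    exists r. split; [exact Hr|]. specialize (HN N (le_n N)). lra. }
  assert (Hpt : forall eps, 0 < eps -> exists N, forall n z, (N <= n)%nat -> K z ->
    Rabs (s n z - g z) <= eps).
  { intros eps Heps. destruct (Hconv eps Heps) as [N HN]. exists N. intros n z Hn Hz.
    destruct (HN n Hn) as [r [Hr Hr']].
    destruct (C1norm_lt_bounded d K _ r eps Hr Hr') as [dh [_ Hdh]]. now apply Hdh. }
  (* The tail after the k-th term has C^1 bound at most [(/ 3) ^ k / 2], so it can undo at most
     [nu k / 2] of the [2 / 3 * nu k] gained, each times [(/ 3) ^ k]. This leaves [/ 6]. *)
  assert (Hg_large : forall k, (/ 3) ^ k * (/ 6 * nu k) <= Rabs (g (y k) - g x)).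
  { intros k. destruct (HT' k) as [Hyk [_ [Hop _]]]. specialize (Hgrow k).
    apply le_epsilon. intros eps Heps.
    destruct (Hpt (eps / 2)) as [N HN]; [lra|]. set (n := max N (S k)).
    pose proof (HN n (y k) ltac:(lia) Hyk) as E1. pose proof (HN n x ltac:(lia) Hx) as E2.
    destruct (Hdiff (S k) n ltac:(lia)) as [dh Hdh].
    assert (Htail : Rabs ((s n (y k) - s (S k) (y k)) - (s n x - s (S k) x))
      <= (/ 3) ^ k * (/ 2 * nu k)).
    { set (q := 2 * 3 ^ k).
      assert (Hq : 0 < q) by (unfold q; assert (0 < 3 ^ k) by (apply pow_lt; lra); lra).
      assert (Hqk : q * (/ 3) ^ k = 2).
      { unfold q. rewrite Rmult_assoc, <- Rpow_mult_distr, Rinv_r, pow1 by lra. ring. }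
      assert (Hb : C1_bounded d K (fun z => q * (s n z - s (S k) z))
        (fun z => vscal q (dh z)) 1).
      { destruct (C1_bounded_scal d K HK q _ _ _ Hdh) as [H1 H2].
        split; [exact H1|]. intros z Hz. destruct (H2 z Hz) as [H5 H6].
        rewrite (Rabs_right q) in H5, H6 by lra.
        enough (q * (3 / 2 * ((/ 3) ^ S k - (/ 3) ^ n)) <= 1) by lra.
        replace (q * (3 / 2 * ((/ 3) ^ S k - (/ 3) ^ n)))
          with (/ 2 * (q * (/ 3) ^ k) - 3 / 2 * (q * (/ 3) ^ n)) by (simpl; field).
        rewrite Hqk. pose proof (Rmult_lt_0_compat q _ Hq (H3 n)). lra. }
      apply Hop in Hb. rewrite <- Rmult_minus_distr_l, Rabs_mult, (Rabs_right q) in Hb by lra.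
      apply (Rmult_le_reg_l q); [exact Hq|].
      rewrite <- (Rmult_assoc q ((/ 3) ^ k)), Hqk. lra. }
    set (A := s (S k) (y k) - s (S k) x) in *.
    set (B := s n (y k) - s (S k) (y k) - (s n x - s (S k) x)) in *.
    set (E := (s n (y k) - g (y k)) - (s n x - g x)).
    assert (HE : Rabs E <= eps) by
      (unfold E; eapply Rle_trans; [apply Rabs_sub_le|lra]).
    assert (HA : Rabs A <= Rabs (g (y k) - g x) + Rabs E + Rabs B).
    { replace A with ((g (y k) - g x) + E - B) by (unfold A, B, E; ring).
      eapply Rle_trans; [apply Rabs_sub_le|]. apply Rplus_le_compat_r, Rabs_triang. }
    lra. }
  destruct Hg as [dg Hdg].
  pose proof (proj1 (is_C1_deriv_hasD d K HK _ _) Hdg x Hx) as [_ Hgx].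
  destruct (hasD_local_lipschitz d K g x (dg x) Hgx 1 Rlt_0_1) as [delta [Hdelta Hlip]].
  set (P := vnorm d (dg x) + 1) in *.
  assert (HP : 0 < P) by (unfold P; pose proof (vnorm_nonneg d (dg x)); lra).
  (* Increments of functions in the unit ball are at most 2, so [2 / 3 * nu k <= 2]; together with
     the smallness of [dist d (y k) x] this drives [y k] to [x]. *)
  assert (Hnu3 : forall k, 0 < nu k <= 3).
  { intros k. destruct (HT' k) as [Hyk [Hfk [_ [Hk Hk']]]].
    pose proof (Rabs_sub_le (f k (y k)) (f k x)).
    pose proof (proj1 (proj2 Hfk (y k) Hyk)). pose proof (proj1 (proj2 Hfk x Hx)).
    pose proof (dist_nonneg d (y k) x). pose proof (pow_lt (/ 4) k ltac:(lra)).
    split; [nra|lra]. }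
  destruct (pow_small (/ 4) 3 delta) as [N1 HN1]; try lra.
  (* The increment of [g] is at least of order [(/ 3) ^ k * nu k] over a distance below
     [(/ 4) ^ k * nu k]. As [(3 / 4) ^ k] tends to 0, this defeats the local Lipschitz constant [P]
     of [g] at [x]. *)
  destruct (pow_small (3 / 4) P (/ 6)) as [N2 HN2]; try lra.
  set (k := max N1 N2). specialize (HN1 k ltac:(lia)). specialize (HN2 k ltac:(lia)).
  destruct (HT' k) as [Hyk [_ [_ [_ Hk]]]]. specialize (Hnu3 k). specialize (Hg_large k).
  pose proof (pow_lt (/ 4) k ltac:(lra)) as H4.
  assert (Hd : dist d (y k) x < delta) by nra.
  specialize (Hlip (y k) Hyk Hd).
  assert (E : (/ 4) ^ k = (3 / 4) ^ k * (/ 3) ^ k)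
    by (rewrite <- Rpow_mult_distr; f_equal; lra).
  assert (P * dist d (y k) x < P * ((/ 4) ^ k * nu k)) by (apply Rmult_lt_compat_l; assumption).
  rewrite E in H. specialize (H3 k).
  assert (0 < (/ 3) ^ k * nu k) by (apply Rmult_lt_0_compat; lra).
  assert (P * (3 / 4) ^ k * ((/ 3) ^ k * nu k) < / 6 * ((/ 3) ^ k * nu k))
    by (apply Rmult_lt_compat_r; assumption).
  nra.
Qed.

End UniformBoundedness.

(** * Smoothing *)

Definition lsum (l : list vec) (h : vec -> R) : R := fold_right (fun z s => h z + s) 0 l.

Lemma lsum_le l g h : (forall z, In z l -> g z <= h z) -> lsum l g <= lsum l h.
Proof.
  induction l as [|z l IH]; intros H; simpl; [lra|].
  apply Rplus_le_compat; [apply H; now left|apply IH; intros; apply H; now right].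
Qed.

Lemma lsum_nonneg l h : (forall z, In z l -> 0 <= h z) -> 0 <= lsum l h.
Proof.
  induction l as [|z l IH]; intros H; simpl; [lra|].
  apply Rplus_le_le_0_compat; [apply H; now left|apply IH; intros; apply H; now right].
Qed.

Lemma lsum_ge_term l h z : (forall z, In z l -> 0 <= h z) -> In z l -> h z <= lsum l h.
Proof.
  induction l as [|a l IH]; intros H Hz; [destruct Hz|]. simpl.
  assert (0 <= lsum l h) by (apply lsum_nonneg; intros; apply H; now right).
  assert (0 <= h a) by (apply H; now left).
  destruct Hz as [->|Hz]; [lra|].
  assert (h z <= lsum l h) by (apply IH; [intros; apply H; now right|exact Hz]). lra.
Qed.

Lemma lsum_scal l c h : lsum l (fun z => c * h z) = c * lsum l h.
Proof. induction l as [|z l IH]; simpl; [ring|]. rewrite IH. ring. Qed.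

Lemma lsum_add l g h : lsum l (fun z => g z + h z) = lsum l g + lsum l h.
Proof. induction l as [|z l IH]; simpl; [ring|]. rewrite IH. ring. Qed.

Lemma lsum_const l c : lsum l (fun _ => c) = INR (length l) * c.
Proof.
  induction l as [|z l IH]; [simpl; ring|].
  change (c + lsum l (fun _ => c) = INR (S (length l)) * c). rewrite IH, S_INR. ring.
Qed.

(* Terms below a quarter of the maximum are negligible in a large power sum: this makes the
   gradient bound of the smoothed function independent of the number of terms. *)
Lemma lsum_pow_bound l v beta z0 k : (forall z, In z l -> 0 <= v z) -> 0 < beta ->
  In z0 l -> beta <= v z0 -> INR (length l) <= 4 ^ k ->
  beta * lsum l (fun z => v z ^ k) <= 5 * lsum l (fun z => v z ^ S k).
Proof.
  intros Hv Hb Hz0 Hvz0 Hk.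
  assert (Hq : 0 <= beta * (beta / 4) ^ k)
    by (apply Rmult_le_pos; [lra|apply pow_le; lra]).
  assert (H1 : beta * lsum l (fun z => v z ^ k)
    <= 4 * lsum l (fun z => v z ^ S k) + INR (length l) * (beta * (beta / 4) ^ k)).
  { rewrite <- lsum_const, <- !lsum_scal, <- lsum_add. apply lsum_le. intros z Hz.
    specialize (Hv z Hz). pose proof (pow_le (v z) k Hv) as Hp. simpl.
    (* Terms above the threshold cost the factor 4. All those below it together cost at most
       [beta ^ S k], which the single term at [z0] covers: 5 is 4 + 1. *)
    destruct (Rle_or_lt (beta / 4) (v z)) as [h|h].
    - apply Rle_trans with (4 * (v z * v z ^ k)); [|lra].
      rewrite <- Rmult_assoc. apply Rmult_le_compat_r; lra.
    - assert (v z ^ k <= (beta / 4) ^ k) by (apply pow_incr; lra).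
      assert (0 <= v z * v z ^ k) by (apply Rmult_le_pos; assumption).
      assert (beta * v z ^ k <= beta * (beta / 4) ^ k) by (apply Rmult_le_compat_l; lra).
      lra. }
  assert (H2 : INR (length l) * (beta * (beta / 4) ^ k) <= beta ^ S k).
  { apply Rle_trans with (4 ^ k * (beta * (beta / 4) ^ k));
      [now apply Rmult_le_compat_r|].
    apply Req_le. simpl. rewrite <- Rmult_assoc, (Rmult_comm (4 ^ k)), Rmult_assoc.
    rewrite <- Rpow_mult_distr. f_equal. f_equal. field. }
  assert (H3 : beta ^ S k <= v z0 ^ S k) by (apply pow_incr; lra).
  assert (H4 : v z0 ^ S k <= lsum l (fun z => v z ^ S k)).
  { apply (lsum_ge_term l (fun z => v z ^ S k)); [|exact Hz0]. intros; apply pow_le; auto. }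
  lra.
Qed.

(** The profile of the bumps: squaring the positive part gives a continuous derivative across 0. *)
Definition possq (t : R) : R := Rmax 0 t * Rmax 0 t.

Lemma derivable_possq t : derivable_pt_lim possq t (2 * Rmax 0 t).
Proof.
  intros eps Heps. exists (mkposreal eps Heps). simpl. intros h Hh Hlt.
  assert (H : Rabs (possq (t + h) - possq t - 2 * Rmax 0 t * h) <= h * h).
  { unfold possq, Rmax. destruct (Rle_dec 0 (t + h)), (Rle_dec 0 t);
      apply Rabs_le; split; nra. }
  replace ((possq (t + h) - possq t) / h - 2 * Rmax 0 t)
    with ((possq (t + h) - possq t - 2 * Rmax 0 t * h) * / h) by (field; assumption).
  rewrite Rabs_mult, Rabs_inv.
  apply Rle_lt_trans with (h * h * / Rabs h).
  - apply Rmult_le_compat_r; [|exact H]. apply Rlt_le, Rinv_0_lt_compat, Rabs_pos_lt, Hh.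
  - replace (h * h) with (Rabs h * Rabs h) by (symmetry; apply (Rsqr_abs h)).
    rewrite Rmult_assoc, Rinv_r by (now apply Rabs_no_R0). lra.
Qed.

Lemma continuity_pt_Rmax0 t : continuity_pt (fun t => 2 * Rmax 0 t) t.
Proof.
  intros eps Heps. exists (eps / 2). split; [lra|]. intros s [_ Hs]. simpl in *.
  unfold Rdist in *. apply Rabs_def2 in Hs as [H1 H2].
  unfold Rmax. apply Rabs_def1; destruct (Rle_dec 0 s), (Rle_dec 0 t); lra.
Qed.

Lemma exp_monotone a b : a <= b -> exp a <= exp b.
Proof. intros [H| ->]; [apply Rlt_le, exp_increasing, H|lra]. Qed.

Lemma ln_monotone a b : 0 < a -> a <= b -> ln a <= ln b.
Proof. intros Ha [H| ->]; [apply Rlt_le, ln_increasing; assumption|lra]. Qed.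

Lemma ln_le_self x : 0 < x -> ln x <= x.
Proof. intros Hx. pose proof (exp_ineq1_le (ln x)) as H. rewrite exp_ln in H; lra. Qed.

Lemma ln_pow_INR x n : 0 < x -> ln (x ^ n) = INR n * ln x.
Proof.
  intros Hx. induction n as [|n IH]; [simpl; rewrite ln_1; ring|].
  rewrite S_INR. simpl pow. rewrite ln_mult, IH; [ring|exact Hx|now apply pow_lt].
Qed.

(** Makes the number of net points itself an admissible exponent [k] in [lsum_pow_bound]. *)
Lemma INR_le_pow4 n : INR n <= 4 ^ n.
Proof.
  induction n as [|n IH]; [simpl; lra|]. rewrite S_INR. simpl.
  assert (1 <= 4 ^ n) by (apply pow_R1_Rle; lra). lra.
Qed.

Section Smoothing.
Context (d : nat) (K : vec -> Prop) (HK : in_Rd d K) (Hc : seq_compact d K).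

(** Compactness in relational form, to serve both for nets and for components. If no finite list
    worked, a greedy choice would give a sequence none of whose terms is related to a later one. *)
Lemma finite_cover (Rel : vec -> vec -> Prop) :
  (forall x, K x -> exists r, 0 < r /\ forall y y', K y -> K y' ->
     dist d y x < r -> dist d y' x < r -> Rel y y') ->
  exists l, (forall x, In x l -> K x) /\ forall y, K y -> exists x, In x l /\ Rel x y.
Proof.
  intros Hloc. apply NNPP. intros Hno.
  assert (Hpick : forall l : list vec, exists y, (forall x, In x l -> K x) ->
    K y /\ forall x, In x l -> ~ Rel x y).
  { intros l. destruct (classic (forall x, In x l -> K x)) as [Hl|Hl]; [|exists vzero; tauto].
    apply NNPP. intros H. apply Hno. exists l. split; [exact Hl|]. intros y Hy.
    apply NNPP. intros H'. apply H. exists y. intros _. split; [exact Hy|].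
    intros x Hx HR. apply H'. now exists x. }
  apply functional_choice in Hpick as [pick Hpick].
  set (L := fix L n := match n with O => nil | S m => pick (L m) :: L m end).
  assert (HL : forall n x, In x (L n) -> K x).
  { induction n as [|n IH]; simpl; [tauto|]. intros x [<-|Hx]; [|auto]. now apply Hpick. }
  assert (Hin : forall m n, (m < n)%nat -> In (pick (L m)) (L n)).
  { intros m n Hmn. induction Hmn; [now left|now right]. }
  destruct (Hc (fun n => pick (L n))) as [phi [Hphi [x [Hx Hlim]]]].
  { intros n. apply Hpick, HL. }
  destruct (Hloc x Hx) as [r [Hr Hrel]]. destruct (Hlim r Hr) as [N HN].
  (* Two successive terms of the convergent subsequence are close to [x], hence related, although
     the later one was picked to avoid this. *)
  apply (proj2 (Hpick (L (phi (S N))) (HL _)) (pick (L (phi N)))); [now apply Hin|].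
  apply Hrel; try (apply Hpick, HL); apply HN; lia.
Qed.

(* [F] is [-(eps/n) ln] of the sum of n-th powers of the bumps [w z], one for each point [z] of an
   [eps/2]-net, with heights [exp (- u z / eps)]; as [u] varies by at most [eps] on the support of
   a bump, all relevant heights are comparable. *)
Lemma smooth_approximation (u : vec -> R) eps : 0 < eps ->
  (forall y y', K y -> K y' -> dist d y y' <= eps -> u y - u y' <= dist d y y') ->
  exists F dF, is_C1_deriv d K F dF /\
    forall y, K y -> vnorm d (dF y) <= 360 /\ Rabs (F y - u y) <= 12 * eps.
Proof.
  intros Heps Hu.
  destruct (finite_cover (fun x y => dist d x y <= eps / 2)) as [l [HlK Hl]].
  { intros x Hx. exists (eps / 4). split; [lra|]. intros y y' _ _ H1 H2.
    pose proof (dist_triangle d y x y'). rewrite (dist_sym d x y') in H. lra. }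
  set (k := length l). set (n := INR (S k)).
  assert (Hn : 0 < n) by (apply lt_0_INR; lia).
  set (B := fun z => exp (- u z / eps)).
  assert (HB : forall z, 0 < B z) by (intros; apply exp_pos).
  (* At least [3 / 4] within [eps / 2] of [z], and at most 0 from distance [eps] on. *)
  set (m := fun z y => 1 + - / (eps * eps) * dot d (vsub y z) (vsub y z)).
  assert (Hee : 0 < / (eps * eps)) by (apply Rinv_0_lt_compat; nra).
  set (w := fun z y => B z * possq (m z y)).
  (* Written exactly as the differentiation lemmas produce it; [vzero] is the derivative of the
     constant 1. *)
  set (dw := fun z y => vscal (B z) (vscal (2 * Rmax 0 (m z y))
    (vadd vzero (vscal (- / (eps * eps)) (vscal 2 (vsub y z)))))).
  assert (Hdw : forall z, is_C1_deriv d K (w z) (dw z)).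
  { intros z. apply is_C1_deriv_scal; [exact HK|].
    apply (is_C1_deriv_comp d K HK (m z) _ possq (fun t => 2 * Rmax 0 t)).
    - apply is_C1_deriv_add; [exact HK|now apply is_C1_deriv_const|].
      apply is_C1_deriv_scal; [exact HK|]. now apply is_C1_deriv_dist_sqr.
    - intros; apply derivable_possq.
    - intros; apply continuity_pt_Rmax0. }
  assert (Hw0 : forall z y, 0 <= w z y).
  { intros z y. apply Rmult_le_pos; [apply Rlt_le, HB|]. unfold possq. nra. }
  assert (Hm1 : forall z y, Rmax 0 (m z y) <= 1).
  { intros z y. apply Rmax_lub; [lra|]. unfold m. pose proof (dot_self_nonneg d (vsub y z)). nra. }
  assert (Hm0 : forall z y, 0 <= Rmax 0 (m z y)) by (intros; apply Rmax_l).
  assert (Hmfar : forall z y, eps <= dist d y z -> Rmax 0 (m z y) = 0).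
  { intros z y H. apply Rmax_left. unfold m. rewrite <- vnorm_sqr. fold (dist d y z).
    assert (H1 : 1 <= / (eps * eps) * (dist d y z * dist d y z)); [|lra].
    replace 1 with (/ (eps * eps) * (eps * eps)) by (field; lra).
    apply Rmult_le_compat_l; [lra|nra]. }
  assert (HBnear : forall z y, K z -> K y -> dist d y z <= eps -> B z <= 3 * B y).
  { intros z y Hz Hy H. specialize (Hu y z Hy Hz H).
    apply Rle_trans with (exp 1 * B y).
    - unfold B. rewrite <- exp_plus. apply exp_monotone.
      replace (1 + - u y / eps) with ((eps - u y) / eps) by (field; lra).
      apply Rmult_le_compat_r; [apply Rlt_le, Rinv_0_lt_compat|]; lra.
    - apply Rmult_le_compat_r; [apply Rlt_le, HB|exact exp_le_3]. }
  assert (Hwup : forall z y, K z -> K y -> w z y <= 3 * B y).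
  { intros z y Hz Hy. unfold w, possq. pose proof (HB z). pose proof (HB y).
    destruct (Rle_or_lt eps (dist d y z)) as [h|h].
    - rewrite (Hmfar z y h). lra.
    - specialize (HBnear z y Hz Hy ltac:(lra)). specialize (Hm1 z y). specialize (Hm0 z y).
      assert (Rmax 0 (m z y) * Rmax 0 (m z y) <= 1) by nra. nra. }
  assert (Hdwup : forall z y, K z -> K y -> vnorm d (dw z y) <= 12 * B y / eps).
  { intros z y Hz Hy. pose proof (HB z) as HBz. pose proof (HB y) as HBy.
    specialize (Hm1 z y). specialize (Hm0 z y).
    assert (E : vnorm d (dw z y)
      = B z * (2 * Rmax 0 (m z y) * (/ (eps * eps) * (2 * dist d y z)))).
    { unfold dw. rewrite !vnorm_scal.
      rewrite (vnorm_ext d (vadd vzero _) (vscal (- / (eps * eps)) (vscal 2 (vsub y z))))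
        by (intros; unfold vadd, vzero; ring).
      rewrite !vnorm_scal, Rabs_Ropp, !Rabs_right by lra. reflexivity. }
    rewrite E. destruct (Rle_or_lt eps (dist d y z)) as [h|h].
    - rewrite (Hmfar z y h). rewrite Rmult_0_r, Rmult_0_l, Rmult_0_r.
      apply Rlt_le, Rdiv_lt_0_compat; lra.
    - specialize (HBnear z y Hz Hy ltac:(lra)). pose proof (dist_nonneg d y z).
      (* The 3 compares [B z] with [B y], one 2 comes from the square in [possq], the other from the
         squared distance. *)
      replace (12 * B y / eps) with (3 * B y * (2 * 1 * (/ (eps * eps) * (2 * eps))))
        by (field; lra).
      apply Rmult_le_compat; [lra| |exact HBnear|].
      + apply Rmult_le_pos; [lra|]. apply Rmult_le_pos; lra.
      + apply Rmult_le_compat; [lra|apply Rmult_le_pos; lra|lra|].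
        apply Rmult_le_compat_l; lra. }
  (* A net point within [eps / 2] has height at least [B y / 3] and profile at least [9 / 16]; the
     product [3 / 16] exceeds [/ 6]. *)
  assert (Hwlow : forall y, K y -> exists z, In z l /\ B y / 6 <= w z y).
  { intros y Hy. destruct (Hl y Hy) as [z [Hz Hzy]]. exists z. split; [exact Hz|].
    assert (HBy : B y <= 3 * B z) by (apply HBnear; auto; lra).
    pose proof (HB y).
    assert (Hm : 3 / 4 <= m z y).
    { unfold m. rewrite <- vnorm_sqr. fold (dist d y z). rewrite (dist_sym d y z).
      pose proof (dist_nonneg d z y).
      assert (/ (eps * eps) * (dist d z y * dist d z y)
        <= / (eps * eps) * (eps / 2 * (eps / 2))) by (apply Rmult_le_compat_l; nra).
      replace (/ (eps * eps) * (eps / 2 * (eps / 2))) with (/ 4) in * by (field; lra).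
      lra. }
    unfold w, possq. rewrite Rmax_right by lra.
    assert (9 / 16 <= m z y * m z y) by nra. nra. }
  set (G := fun y => lsum l (fun z => w z y ^ S k)).
  set (dG := fun y => fold_right
    (fun z v => vadd (vscal (n * w z y ^ k) (dw z y)) v) vzero l).
  assert (HG : is_C1_deriv d K G dG).
  { unfold G, dG, lsum, n. clear - HK Hdw. clearbody k.
    induction l as [|z l' IH]; cbn [fold_right].
    - now apply is_C1_deriv_const.
    - apply (is_C1_deriv_add d K HK (fun y => w z y ^ S k)); [|exact IH].
      apply (is_C1_deriv_comp d K HK (w z) _ (fun t => t ^ S k) (fun t => INR (S k) * t ^ k)).
      + apply Hdw.
      + intros. exact (derivable_pt_lim_pow (w z x) (S k)).
      + intros. apply derivable_continuous_pt.
        apply (derivable_pt_scal (fun t => t ^ k)). apply derivable_pt_pow. }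
  assert (HGlow : forall y, K y -> (B y / 6) ^ S k <= G y).
  { intros y Hy. destruct (Hwlow y Hy) as [z [Hz Hzw]]. specialize (HB y).
    apply Rle_trans with (w z y ^ S k); [apply pow_incr; lra|].
    apply (lsum_ge_term l (fun z => w z y ^ S k)); [|exact Hz]. intros; now apply pow_le. }
  assert (HGpos : forall y, K y -> 0 < G y).
  { intros y Hy. eapply Rlt_le_trans; [|now apply HGlow]. apply pow_lt. specialize (HB y). lra. }
  (* The number of terms is at most [4 ^ S k], so it is absorbed into the base: 12 is 4 times 3.
     After the root of order [n] it costs only a constant. *)
  assert (HGup : forall y, K y -> G y <= (12 * B y) ^ S k).
  { intros y Hy. pose proof (HB y) as HBy.
    apply Rle_trans with (lsum l (fun _ => (3 * B y) ^ S k)).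
    - apply lsum_le. intros z Hz. apply pow_incr. split; [apply Hw0|]. apply Hwup; auto.
    - rewrite lsum_const. replace (12 * B y) with (4 * (3 * B y)) by ring.
      rewrite (Rpow_mult_distr 4). apply Rmult_le_compat_r; [apply pow_le; lra|].
      fold k. pose proof (INR_le_pow4 k). simpl. assert (0 < 4 ^ k) by (apply pow_lt; lra). lra. }
  exists (fun y => - (eps / n) * ln (G y)),
    (fun y => vscal (- (eps / n)) (vscal (/ G y) (dG y))). split.
  { apply is_C1_deriv_scal; [exact HK|].
    apply (is_C1_deriv_comp d K HK G dG ln Rinv HG).
    - intros x Hx. apply derivable_pt_lim_ln. now apply HGpos.
    - intros x Hx. apply (continuity_pt_inv id); [apply derivable_continuous_pt, derivable_pt_id|].
      specialize (HGpos x Hx). unfold id. lra. }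
  intros y Hy. specialize (HGpos y Hy). specialize (HGlow y Hy). specialize (HGup y Hy).
  pose proof (HB y) as HBy.
  assert (Hen : 0 < eps / n) by now apply Rdiv_lt_0_compat.
  split.
  - assert (H1 : vnorm d (dG y) <= n * (12 * B y / eps) * lsum l (fun z => w z y ^ k)).
    { unfold dG. clear HG HGlow HGup HGpos. assert (Hk : 0 <= n) by lra.
      clearbody k n. clear Hl Hwlow. induction l as [|z l' IH]; simpl.
      - rewrite vnorm_zero. lra.
      - eapply Rle_trans; [apply vnorm_add|]. rewrite Rmult_plus_distr_l.
        apply Rplus_le_compat; [|apply IH; intros; apply HlK; now right].
        rewrite vnorm_scal. pose proof (pow_le (w z y) k (Hw0 z y)) as Hp.
        rewrite Rabs_right by (apply Rle_ge, Rmult_le_pos; assumption).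
        replace (n * (12 * B y / eps) * w z y ^ k)
          with (n * w z y ^ k * (12 * B y / eps)) by ring.
        apply Rmult_le_compat_l; [now apply Rmult_le_pos|].
        apply Hdwup; [apply HlK; now left|exact Hy]. }
    destruct (Hwlow y Hy) as [z [Hz Hzw]].
    assert (H2 : B y / 6 * lsum l (fun z => w z y ^ k) <= 5 * G y).
    { apply (lsum_pow_bound l (fun z => w z y) _ z); auto; [lra|apply INR_le_pow4]. }
    rewrite !vnorm_scal, Rabs_Ropp, !Rabs_right
      by (apply Rle_ge, Rlt_le; try apply Rinv_0_lt_compat; assumption).
    set (S0 := lsum l (fun z => w z y ^ k)) in *.
    apply Rle_trans with (eps / n * (/ G y * (n * (12 * B y / eps) * S0))).
    + apply Rmult_le_compat_l; [lra|]. apply Rmult_le_compat_l; [|exact H1].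
      apply Rlt_le, Rinv_0_lt_compat, HGpos.
    (* The 72 is 12 from the gradient of a bump times 6 from [Hwlow]; the factor 5 of
       [lsum_pow_bound] makes it 360. *)
    + replace (eps / n * (/ G y * (n * (12 * B y / eps) * S0)))
        with (72 * (B y / 6 * S0) * / G y) by (field; lra).
      apply Rle_trans with (72 * (5 * G y) * / G y).
      * apply Rmult_le_compat_r; [apply Rlt_le, Rinv_0_lt_compat, HGpos|lra].
      * apply Req_le. field. lra.
  - assert (L1 : n * (- u y / eps - ln 6) <= ln (G y)).
    { replace (- u y / eps - ln 6) with (ln (B y / 6)).
      - unfold n. rewrite <- ln_pow_INR by lra. apply ln_monotone; [apply pow_lt; lra|exact HGlow].
      - unfold Rdiv at 1. rewrite ln_mult, ln_Rinv by lra. unfold B. rewrite ln_exp. ring. }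
    assert (L2 : ln (G y) <= n * (ln 12 + - u y / eps)).
    { replace (ln 12 + - u y / eps) with (ln (12 * B y)).
      - unfold n. rewrite <- ln_pow_INR by lra. apply ln_monotone; [exact HGpos|exact HGup].
      - rewrite ln_mult by lra. unfold B. now rewrite ln_exp. }
    (* The crude bounds [ln 12 <= 12] and [ln 6 <= 6] are the origin of the error [12 * eps]. *)
    pose proof (ln_le_self 12 ltac:(lra)) as M1. pose proof (ln_le_self 6 ltac:(lra)) as M2.
    apply (Rmult_le_compat_l (eps / n)) in L1; [|lra].
    apply (Rmult_le_compat_l (eps / n)) in L2; [|lra].
    replace (eps / n * (n * (- u y / eps - ln 6))) with (- u y - eps * ln 6) in L1
      by (field; lra).
    replace (eps / n * (n * (ln 12 + - u y / eps))) with (eps * ln 12 - u y) in L2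
      by (field; lra).
    assert (eps * ln 12 <= eps * 12) by (apply Rmult_le_compat_l; lra).
    assert (eps * ln 6 <= eps * 6) by (apply Rmult_le_compat_l; lra).
    apply Rabs_le. split; lra.
Qed.

End Smoothing.

(** * Short paths from completeness *)

Lemma Rabs_le_bounds a b : Rabs a <= b -> - b <= a <= b.
Proof. intros H. unfold Rabs in H. destruct (Rcase_abs a); lra. Qed.

Section Chains.
Context (d : nat) (K : vec -> Prop) (HK : in_Rd d K) (Hc : seq_compact d K).

Inductive chain (eps : R) (x : vec) : vec -> R -> Prop :=
| chain_nil : chain eps x x 0
| chain_snoc z y l : chain eps x z l -> K y -> dist d z y <= eps ->
    chain eps x y (l + dist d z y).

Lemma chain_length_nonneg eps x y l : chain eps x y l -> 0 <= l.
Proof. induction 1 as [|z y l _ IH _ _]; [lra|]. pose proof (dist_nonneg d z y). lra. Qed.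

Lemma chain_weaken e e' x y l : e <= e' -> chain e x y l -> chain e' x y l.
Proof. intros He. induction 1; [apply chain_nil|apply chain_snoc; auto; lra]. Qed.

(* Truncating the chain distance at 1 keeps it finite and bounds it. *)
Lemma truncated_chain_distance eps x : exists u : vec -> R,
  (forall y, 0 <= u y <= 1) /\ u x = 0 /\
  (forall y y', K y -> K y' -> dist d y y' <= eps -> u y - u y' <= dist d y y') /\
  (forall y c, u y < c -> c <= 1 -> exists l, chain eps x y l /\ l < c).
Proof.
  set (E := fun y r => r = 1 \/ chain eps x y r).
  assert (HE0 : forall y r, E y r -> 0 <= r).
  { intros y r [->|H]; [lra|exact (chain_length_nonneg _ _ _ _ H)]. }
  assert (Hu : forall y, exists m, is_glb (E y) m).
  { intros y. apply (is_glb_exists (E y) 0 1); [apply HE0|now left]. }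
  apply functional_choice in Hu as [u Hu]. exists u.
  assert (H01 : forall y, 0 <= u y <= 1).
  { intros y. destruct (Hu y) as [H1 H2]. split; [apply H2, HE0|apply H1; now left]. }
  split; [exact H01|]. split; [|split].
  - apply Rle_antisym; [|apply H01]. apply (proj1 (Hu x)). right. apply chain_nil.
  - intros y y' Hy _ Hd. enough (u y - dist d y y' <= u y') by lra.
    apply (proj2 (Hu y')). intros r [->|Hr].
    + pose proof (H01 y). pose proof (dist_nonneg d y y'). lra.
    + enough (u y <= r + dist d y' y) by (rewrite (dist_sym d y y'); lra).
      apply (proj1 (Hu y)). right. apply chain_snoc; auto. now rewrite dist_sym.
  - intros y c Hc1 Hc2. apply NNPP. intros H. enough (c <= u y) by lra.
    apply (proj2 (Hu y)). intros r [->|Hr]; [exact Hc2|].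
    apply Rnot_lt_le. intros Hlt. apply H. now exists r.
Qed.

Lemma C1_complete_short_chains : C1_complete d K -> forall x, K x ->
  exists r C, 0 < r /\ 0 < C /\ forall y, K y -> dist d y x < r ->
    forall eps, 0 < eps -> exists l, chain eps x y l /\ l <= C * dist d x y.
Proof.
  intros Hcomp x Hx.
  destruct (C1_complete_uniform_lipschitz d K HK Hcomp x Hx) as [C0 [HC0 Hlip]].
  (* Scaling [F] into the unit ball costs the factor 360; the extra 1 absorbs the smoothing
     error. *)
  set (C := 361 * C0). assert (HC : 0 < C) by (unfold C; lra).
  (* Within distance [/ C] of [x] the bound [C * dist d y x] is below 1, so the truncation is
     inactive and a small value of [u y] comes from an actual chain. *)
  exists (/ C), C. split; [now apply Rinv_0_lt_compat|]. split; [exact HC|].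
  intros y Hy Hyx eps Heps. rewrite (dist_sym d x y).
  destruct (Rle_lt_or_eq_dec 0 (dist d y x) (dist_nonneg d y x)) as [Hpos|H0].
  2: { rewrite (K_dist_eq_0 d K HK y x Hy Hx (eq_sym H0)), dist_refl.
       exists 0. split; [apply chain_nil|lra]. }
  assert (HCd : C * dist d y x < 1).
  { apply (Rmult_lt_compat_l C) in Hyx; [|exact HC]. rewrite Rinv_r in Hyx; lra. }
  set (D := C0 * dist d y x).
  assert (HD : 0 < D) by now apply Rmult_lt_0_compat.
  (* With [e <= D / 48] the two errors [12 * e], at [x] and at [y], amount to at most [D / 2]; with
     [e <= 1] the values of [F] are bounded by 13. *)
  set (e := Rmin eps (Rmin 1 (D / 48))).
  assert (He : 0 < e) by (repeat apply Rmin_glb_lt; lra).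
  assert (He1 : e <= eps) by apply Rmin_l.
  assert (He2 : e <= 1) by (eapply Rle_trans; [apply Rmin_r|apply Rmin_l]).
  assert (He3 : e <= D / 48) by (eapply Rle_trans; [apply Rmin_r|apply Rmin_r]).
  destruct (truncated_chain_distance e x) as [u [Hu01 [Hux [Hulip Huchain]]]].
  destruct (smooth_approximation d K HK Hc u e He Hulip) as [F [dF [HF HFb]]].
  assert (Hb : C1_bounded d K (fun z => / 360 * F z) (fun z => vscal (/ 360) (dF z)) 1).
  { split; [now apply is_C1_deriv_scal|]. intros z Hz. destruct (HFb z Hz) as [H1 H2].
    rewrite vnorm_scal, Rabs_mult, (Rabs_right (/ 360)) by lra. split; [|lra].
    specialize (Hu01 z). apply Rabs_le_bounds in H2.
    enough (Rabs (F z) <= 360) by lra. apply Rabs_le. lra. }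
  pose proof (Hlip _ _ Hb y Hy) as HFyx. cbv beta in HFyx.
  rewrite <- Rmult_minus_distr_l, Rabs_mult, (Rabs_right (/ 360)) in HFyx by lra.
  fold D in HFyx. pose proof (Rle_abs (F y - F x)).
  destruct (HFb y Hy) as [_ H1]. destruct (HFb x Hx) as [_ H2].
  apply Rabs_le_bounds in H1, H2.
  destruct (Huchain y (C * dist d y x)) as [l [Hl Hlt]].
  - replace (C * dist d y x) with (361 * D) by (unfold C, D; ring). lra.
  - lra.
  - exists l. split; [exact (chain_weaken e eps x y l He1 Hl)|lra].
Qed.

(** Interpolating between the points of a chain would leave [K], so a step function timed by the
    length travelled is used. It waits at each point and then jumps by at most [eps]. A step of
    length 0 may already change the value at time 0, so only times before 0 are sure to give [x]. *)
Lemma chain_step_path eps x y l : 0 <= eps -> K x -> chain eps x y l ->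
  exists g : R -> vec, (forall t, K (g t)) /\ (forall t, t < 0 -> g t = x) /\
    (forall t, l <= t -> g t = y) /\
    forall s t, dist d (g s) (g t) <= Rabs (s - t) + eps.
Proof.
  intros Heps Hx. induction 1 as [|z y l Hz [g [H1 [H2 [H3 H4]]]] Hy Hd].
  - exists (fun _ => x). repeat split; auto. intros s t. rewrite dist_refl.
    pose proof (Rabs_pos (s - t)). lra.
  - pose proof (chain_length_nonneg _ _ _ _ Hz) as Hl. pose proof (dist_nonneg d z y) as Hn.
    assert (Haux : forall s t, s < l + dist d z y <= t ->
      dist d (g s) y <= Rabs (s - t) + eps).
    { intros s t Hst. rewrite Rabs_left by lra.
      destruct (Rle_or_lt l s) as [h|h]; [rewrite (H3 s h); lra|].
      specialize (H4 s l). rewrite (H3 l) in H4 by lra. rewrite Rabs_left in H4 by lra.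
      pose proof (dist_triangle d (g s) z y). lra. }
    exists (fun t => if Rlt_dec t (l + dist d z y) then g t else y).
    split; [|split; [|split]].
    + intros t. destruct (Rlt_dec _ _); auto.
    + intros t Ht. destruct (Rlt_dec _ _); [auto|lra].
    + intros t Ht. destruct (Rlt_dec _ _); [lra|reflexivity].
    + intros s t. destruct (Rlt_dec s _), (Rlt_dec t _).
      * apply H4.
      * apply Haux. lra.
      * rewrite dist_sym, Rabs_minus_sym. apply Haux. lra.
      * rewrite dist_refl. pose proof (Rabs_pos (s - t)). lra.
Qed.

Lemma strictly_increasing_ge (phi : nat -> nat) :
  (forall n, (phi n < phi (S n))%nat) -> forall n, (n <= phi n)%nat.
Proof. intros H n. induction n as [|n IH]; [lia|]. specialize (H n). lia. Qed.

(** Stage [j] makes column [j] converge and refines the earlier stages; the diagonal then treats all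
    columns at once. *)
Lemma diagonal_extraction (G : nat -> nat -> vec) : (forall k j, K (G k j)) ->
  exists phi : nat -> nat, (forall k, (k <= phi k)%nat) /\
    forall j, exists x, seq_conv d (fun k => G (phi k) j) x.
Proof.
  intros HG.
  (* The pair holds the extraction reached so far and the next column, so that one use of choice
     covers all stages. *)
  assert (Hext : forall p : (nat -> nat) * nat, exists psi : nat -> nat,
    (forall n, (n <= psi n)%nat) /\
    exists x, seq_conv d (fun n => G (fst p (psi n)) (snd p)) x).
  { intros [sigma j]. destruct (Hc (fun n => G (sigma n) j)) as [psi [Hpsi [x [_ Hx]]]].
    - auto.
    - exists psi. split; [now apply strictly_increasing_ge|]. now exists x. }
  apply functional_choice in Hext as [ext Hext].
  set (A := fix A j : nat -> nat := match j with
    | O => ext (fun n => n, O)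
    | S i => fun n => A i (ext (A i, S i) n)
    end).
  assert (Hlim : forall j, exists x, seq_conv d (fun n => G (A j n) j) x).
  { intros [|j]; [exact (proj2 (Hext (fun n => n, O)))|exact (proj2 (Hext (A j, S j)))]. }
  (* Each later stage runs through stage [j] at indices that are no smaller, so from [j] on the
     diagonal inherits the convergence of column [j]. *)
  assert (HA : forall j k, (j <= k)%nat -> forall n, exists m, (n <= m)%nat /\ A k n = A j m).
  { intros j k Hjk. induction Hjk as [|k Hjk IH]; intros n; [now exists n|].
    destruct (IH (ext (A k, S k) n)) as [m [Hm Em]]. exists m.
    pose proof (proj1 (Hext (A k, S k)) n). split; [lia|exact Em]. }
  assert (HA0 : forall k n, (n <= A k n)%nat).
  { intros k n. destruct (HA O k (Nat.le_0_l k) n) as [m [Hm ->]].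
    pose proof (proj1 (Hext (fun n => n, O)) m). simpl. lia. }
  exists (fun k => A k k). split; [auto|]. intros j.
  destruct (Hlim j) as [x Hx]. exists x. intros eps Heps. destruct (Hx eps Heps) as [N HN].
  exists (max N j). intros k Hk. destruct (HA j k ltac:(lia) k) as [m [Hm ->]].
  apply HN. lia.
Qed.

Lemma cauchy_seq_conv (u : nat -> vec) : (forall n, K (u n)) ->
  (forall eps, 0 < eps -> exists N, forall k l, (N <= k)%nat -> (N <= l)%nat ->
     dist d (u k) (u l) < eps) ->
  exists x, K x /\ seq_conv d u x.
Proof.
  intros HuK Hu. destruct (Hc u HuK) as [phi [Hphi [x [Hx Hlim]]]].
  exists x. split; [exact Hx|]. intros eps Heps.
  destruct (Hu (eps / 2)) as [N HN]; [lra|]. destruct (Hlim (eps / 2)) as [N' HN']; [lra|].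
  exists N. intros n Hn. set (m := max N N').
  pose proof (strictly_increasing_ge phi Hphi m).
  specialize (HN n (phi m) Hn ltac:(lia)). specialize (HN' m ltac:(lia)).
  pose proof (dist_triangle d (u n) (u (phi m)) x). lra.
Qed.

Lemma nat_floor x : 0 <= x -> exists m, INR m <= x < INR m + 1.
Proof.
  intros Hx. destruct (archimed x) as [H1 H2]. exists (Z.to_nat (up x - 1)).
  assert (0 < up x)%Z by (apply lt_IZR; lra).
  rewrite INR_IZR_INZ, Z2Nat.id, minus_IZR by lia. lra.
Qed.

(** An enumeration, with repetitions, of the nonnegative rationals. *)
Definition grid (j : nat) : R := let '(n, m) := Cantor.of_nat j in INR m / INR (S n).

Lemma grid_dense t eta : 0 <= t -> 0 < eta -> exists j, Rabs (t - grid j) < eta.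
Proof.
  intros Ht Heta. destruct (archimed_cor1 eta Heta) as [N [HN HN0]].
  destruct N as [|n]; [lia|].
  assert (Hp : 0 < INR (S n)) by (apply lt_0_INR; lia).
  destruct (nat_floor (t * INR (S n))) as [m [Hm1 Hm2]]; [apply Rmult_le_pos; lra|].
  exists (Cantor.to_nat (n, m)). unfold grid. rewrite Cantor.cancel_of_to.
  replace (t - INR m / INR (S n)) with ((t * INR (S n) - INR m) * / INR (S n))
    by (field; lra).
  rewrite Rabs_mult, !Rabs_right by (try apply Rle_ge, Rlt_le, Rinv_0_lt_compat; lra).
  apply Rle_lt_trans with (1 * / INR (S n)); [|lra].
  apply Rmult_le_compat_r; [apply Rlt_le, Rinv_0_lt_compat|]; lra.
Qed.

(* Arzela-Ascoli for the step functions along chains of mesh tending to 0. *)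
Lemma path_of_chains x y L : K x -> K y -> 0 <= L ->
  (forall eps, 0 < eps -> exists l, chain eps x y l /\ l <= L) ->
  exists g, path_in d K g 0 L x y L.
Proof.
  intros Hx Hy HL Hchain.
  set (e := fun k => / INR (S k)).
  assert (He0 : forall k, 0 < e k) by (intros; apply Rinv_0_lt_compat, lt_0_INR; lia).
  assert (He : forall eps, 0 < eps -> exists N, forall k, (N <= k)%nat -> e k < eps).
  { intros eps Heps. destruct (archimed_cor1 eps Heps) as [N [HN HN0]]. exists N.
    intros k Hk. eapply Rle_lt_trans; [|exact HN].
    apply Rinv_le_contravar; [now apply lt_0_INR|apply le_INR; lia]. }
  assert (Hg : forall k, exists g : R -> vec, (forall t, K (g t)) /\
    (forall t, t < 0 -> g t = x) /\ (forall t, L <= t -> g t = y) /\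
    forall s t, dist d (g s) (g t) <= Rabs (s - t) + e k).
  { intros k. destruct (Hchain (e k) (He0 k)) as [l [Hl HlL]].
    destruct (chain_step_path (e k) x y l (Rlt_le _ _ (He0 k)) Hx Hl) as [g [H1 [H2 [H3 H4]]]].
    exists g. repeat split; auto. intros t Ht. apply H3. lra. }
  apply functional_choice in Hg as [g Hg].
  destruct (diagonal_extraction (fun k j => g k (grid j))) as [phi [Hphi Hlim]].
  { intros; apply Hg. }
  assert (Hephi : forall eps, 0 < eps -> exists N, forall k, (N <= k)%nat -> e (phi k) < eps).
  { intros eps Heps. destruct (He eps Heps) as [N HN]. exists N. intros k Hk.
    apply HN. specialize (Hphi k). lia. }
  assert (Hgam : forall t, exists p, 0 <= t -> K p /\ seq_conv d (fun k => g (phi k) t) p).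
  { intros t. destruct (Rle_or_lt 0 t) as [Ht|Ht]; [|exists x; lra].
    destruct (cauchy_seq_conv (fun k => g (phi k) t)) as [p Hp].
    - intros; apply Hg.
    - intros eps Heps.
      (* Moving from [t] to a nearby grid point costs [eps / 8] for the time and [eps / 8] for the
         jump; convergence at the grid point costs a third [eps / 8]. *)
      destruct (grid_dense t (eps / 8) Ht ltac:(lra)) as [j Hj].
      destruct (Hlim j) as [xj Hxj]. destruct (Hxj (eps / 8)) as [N1 HN1]; [lra|].
      destruct (Hephi (eps / 8)) as [N2 HN2]; [lra|].
      assert (Hclose : forall k, (max N1 N2 <= k)%nat -> dist d (g (phi k) t) xj < 3 / 8 * eps).
      { intros k Hk. specialize (HN1 k ltac:(lia)). specialize (HN2 k ltac:(lia)).
        destruct (Hg (phi k)) as [_ [_ [_ H4]]]. specialize (H4 t (grid j)).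
        pose proof (dist_triangle d (g (phi k) t) (g (phi k) (grid j)) xj). lra. }
      exists (max N1 N2). intros k l Hk Hl. pose proof (Hclose k Hk).
      pose proof (Hclose l Hl) as H2.
      pose proof (dist_triangle d (g (phi k) t) xj (g (phi l) t)).
      rewrite (dist_sym d xj) in H0. lra.
    - exists p. auto. }
  apply functional_choice in Hgam as [gam Hgam].
  (* The jumps vanish in the limit, which is therefore exactly 1-Lipschitz; this gives both
     continuity and the length bound. *)
  assert (Hlip : forall s t, 0 <= s -> 0 <= t -> dist d (gam s) (gam t) <= Rabs (s - t)).
  { intros s t Hs Ht. apply le_epsilon. intros eps Heps.
    destruct (proj2 (Hgam s Hs) (eps / 3)) as [N1 HN1]; [lra|].
    destruct (proj2 (Hgam t Ht) (eps / 3)) as [N2 HN2]; [lra|].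
    destruct (Hephi (eps / 3)) as [N3 HN3]; [lra|].
    set (k := max N1 (max N2 N3)).
    specialize (HN1 k ltac:(lia)). specialize (HN2 k ltac:(lia)). specialize (HN3 k ltac:(lia)).
    destruct (Hg (phi k)) as [_ [_ [_ H4]]]. specialize (H4 s t).
    rewrite dist_sym in HN1.
    pose proof (dist_triangle d (gam s) (g (phi k) s) (gam t)).
    pose proof (dist_triangle d (g (phi k) s) (g (phi k) t) (gam t)). lra. }
  exists gam. split; [exact HL|]. split; [|split; [|split; [|split]]].
  - intros t Ht. now apply Hgam.
  - intros t Ht eps Heps. exists eps. split; [exact Heps|]. intros s Hs Hst.
    eapply Rle_lt_trans; [apply Hlip; lra|exact Hst].
  - apply (K_dist_eq_0 d K HK); [apply Hgam; lra|exact Hx|].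
    apply Rle_antisym; [|apply dist_nonneg]. apply le_epsilon. intros eps Heps.
    destruct (proj2 (Hgam 0 (Rle_refl 0)) (eps / 3)) as [N1 HN1]; [lra|].
    destruct (Hephi (eps / 3)) as [N2 HN2]; [lra|].
    set (k := max N1 N2). specialize (HN1 k ltac:(lia)). specialize (HN2 k ltac:(lia)).
    (* The step functions are known to equal [x] only before time 0, hence the comparison with a
       slightly negative time. *)
    destruct (Hg (phi k)) as [_ [H2 [_ H4]]]. specialize (H4 0 (- (eps / 3))).
    rewrite (H2 (- (eps / 3))) in H4 by lra. rewrite (Rabs_right (0 - - (eps / 3))) in H4 by lra.
    rewrite dist_sym in HN1.
    pose proof (dist_triangle d (gam 0) (g (phi k) 0) x). lra.
  - apply (K_dist_eq_0 d K HK); [now apply Hgam|exact Hy|].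
    apply Rle_antisym; [|apply dist_nonneg]. apply le_epsilon. intros eps Heps.
    destruct (proj2 (Hgam L HL) eps Heps) as [N HN]. specialize (HN N (le_n N)).
    destruct (Hg (phi N)) as [_ [_ [H3 _]]]. rewrite (H3 L (Rle_refl L)), dist_sym in HN. lra.
  - intros n t [Ht0 [Htn Hmono]].
    enough (forall i, (i <= n)%nat -> 0 <= t i /\
      sumR i (fun j => dist d (gam (t (S j))) (gam (t j))) <= t i) as H
      by (rewrite <- Htn; now apply H).
    induction i as [|i IH]; intros Hi; simpl; [lra|].
    destruct (IH ltac:(lia)) as [IH1 IH2]. specialize (Hmono i ltac:(lia)).
    split; [lra|]. pose proof (Hlip (t (S i)) (t i) ltac:(lra) IH1) as H.
    rewrite Rabs_right in H by lra. lra.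
Qed.

Lemma C1_complete_local_paths : C1_complete d K -> forall x, K x ->
  exists r C, 0 < r /\ 0 < C /\ forall y, K y -> dist d y x < r ->
    exists g a b, path_in d K g a b x y (C * dist d x y).
Proof.
  intros Hcomp x Hx. destruct (C1_complete_short_chains Hcomp x Hx) as [r [C [Hr [HC H]]]].
  exists r, C. split; [exact Hr|]. split; [exact HC|]. intros y Hy Hyx.
  destruct (path_of_chains x y (C * dist d x y) Hx Hy) as [g Hg].
  - apply Rmult_le_pos; [lra|apply dist_nonneg].
  - now apply H.
  - now exists g, 0, (C * dist d x y).
Qed.

Lemma C1_complete_finitely_many_components :
  C1_complete d K -> finitely_many_components d K.
Proof.
  intros Hcomp. apply (finite_cover d K Hc (component d K)). intros x Hx.
  destruct (C1_complete_local_paths Hcomp x Hx) as [r [C [Hr [_ H]]]].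
  assert (Hx' : forall y, K y -> dist d y x < r -> component d K x y).
  { intros y Hy Hyx. destruct (H y Hy Hyx) as [g [a [b Hg]]].
    apply path_in_component in Hg as [Hab [HgK [_ [_ [<- _]]]]]. apply HgK. lra. }
  exists r. split; [exact Hr|]. intros y y' Hy Hy' H1 H2.
  apply (component_trans d K y x y'); [apply component_sym|]; auto.
Qed.

(** The base point has to range over the whole component, so local paths are taken at [z]; they stay
    in the component of [z], which is contained in that of [x]. *)
Lemma C1_complete_Whitney_regular : C1_complete d K ->
  forall x, K x -> pointwise_Whitney_regular d (component d K x).
Proof.
  intros Hcomp x Hx z Hz.
  destruct (C1_complete_local_paths Hcomp z (component_subset d K x z Hz))
    as [r [C [Hr [HC H]]]].
  exists r, C. split; [exact Hr|]. split; [exact HC|]. intros y Hy Hyz.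
  destruct (H y (component_subset d K x y Hy) Hyz) as [g [a [b Hg]]]. exists g, a, b.
  apply path_in_component in Hg. revert Hg. apply path_in_subset.
  intros w. now apply component_trans.
Qed.

End Chains.

Theorem mainTheorem10 (d : nat) (K : vec -> Prop)
  (HK : in_Rd d K) (Hc : seq_compact d K) :
  C1_complete d K <->
  (finitely_many_components d K /\
   forall x, K x -> pointwise_Whitney_regular d (component d K x)).
Proof.
  split.
  - intros Hcomp. split; [now apply C1_complete_finitely_many_components|].
    now apply C1_complete_Whitney_regular.
  - intros [Hfin HW]. now apply C1_complete_of_Whitney_regular.
Qed.
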